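(* Let $n\in\mathbb N_0$, $\beta,\gamma\in(-1,1)\setminus\{0\}$, $0<|q|<1$, $|t|<1$. Then, with $x=\cos\theta$, $$\int_{-1}^1\frac{(t\beta e^{i\theta},t\beta e^{-i\theta};q)_\infty}{(te^{i\theta},te^{-i\theta};q)_\infty}\,C_n(x;\gamma|q)\,\frac{w(x;\gamma|q)}{\sqrt{1-x^2}}\,dx=2\pi\,\frac{(\gamma,\gamma q;q)_\infty\,(\beta,\gamma^2;q)_n}{(\gamma^2,q;q)_\infty\,(q,q\gamma;q)_n}\;{}_2\phi_1\left(\begin{array}{c}\beta\gamma^{-1},\ \beta q^n\\ \gamma q^{n+1}\end{array};q,\gamma t^2\right)t^n .$$
   Context: $q$-Pochhammer symbols: $(a;q)_0=1$, $(a;q)_n=(1-a)(1-aq)\cdots(1-aq^{n-1})$, $(a;q)_\infty=\prod_{n\ge0}(1-aq^n)$, and $(a_1,\ldots,a_r;q)_n=(a_1;q)_n\cdots(a_r;q)_n$ (also for $n=\infty$). Basic hypergeometric series: ${}_r\phi_s\left(\begin{array}{c}a_1,\ldots,a_r\\ b_1,\ldots,b_s\end{array};q,z\right)=\sum_{k=0}^\infty\frac{(a_1,\ldots,a_r;q)_k}{(q,b_1,\ldots,b_s;q)_k}\left((-1)^kq^{\binom k2}\right)^{1+s-r}z^k$. The continuous $q$-ultraspherical/Rogers polynomials are $C_n(x;\beta|q)=\frac{(\beta;q)_n}{(q;q)_n}e^{in\theta}\,{}_2\phi_1\left(\begin{array}{c}q^{-n},\ \beta\\ \beta^{-1}q^{1-n}\end{array};q,q\beta^{-1}e^{-2i\theta}\right)$,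 $x=\cos\theta$. The weight function $w$ on $(-1,1)$ is $w(x;\gamma|q)=\left|\frac{(e^{2i\theta};q)_\infty}{(\gamma e^{2i\theta};q)_\infty}\right|^2$, $x=\cos\theta$.
   Formalization: The base q is taken real with 0<|q|<1 (t is complex); for non-real q the identity fails, e.g. n=0, t=0, q=i/2, small γ, where the left side is real and the right side is not. *)

(* Defs.v *)
From Stdlib Require Import Reals ZArith List.
From Coquelicot Require Import Coquelicot.
Import ListNotations.
Open Scope C_scope.

Definition Cpowz (z : C) (m : Z) : C :=
  match m with
  | Z0 => 1
  | Zpos p => z ^ Pos.to_nat p
  | Zneg p => / z ^ Pos.to_nat p
  end.

(* Total, like [Lim_seq] and [Series]: meaningful when the sequence (series)
   converges, see [CLim_seq_unique] and [CSeries_unique]. *)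
Definition CLim_seq (u : nat -> C) : C :=
  (real (Lim_seq (fun n => Re (u n))), real (Lim_seq (fun n => Im (u n)))).

Definition CSeries (a : nat -> C) : C :=
  CLim_seq (fun n => sum_n a n).

Lemma CLim_seq_unique (u : nat -> C) (l : C) :
  filterlim u eventually (locally l) -> CLim_seq u = l.
Proof.
  intros H.
  assert (HRe : is_lim_seq (fun n => Re (u n)) (Finite (Re l))).
  { apply filterlim_locally; intros eps.
    apply (proj1 (filterlim_locally u l)) with (eps := eps) in H.
    revert H; apply filter_imp; intros n Hn; exact (proj1 Hn). }
  assert (HIm : is_lim_seq (fun n => Im (u n)) (Finite (Im l))).
  { apply filterlim_locally; intros eps.
    apply (proj1 (filterlim_locally u l)) with (eps := eps) in H.
    revert H; apply filter_imp; intros n Hn; exact (proj2 Hn). }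
  unfold CLim_seq.
  rewrite (is_lim_seq_unique _ _ HRe), (is_lim_seq_unique _ _ HIm).
  destruct l; reflexivity.
Qed.

Lemma CSeries_unique (a : nat -> C) (l : C) :
  is_series a l -> CSeries a = l.
Proof. exact (CLim_seq_unique _ l). Qed.

Definition expi (phi : R) : C := (cos phi, sin phi).

Fixpoint qpoch (a q : C) (n : nat) : C :=
  match n with
  | O => 1
  | S m => qpoch a q m * (1 - a * q ^ m)
  end.

Definition qpoch_inf (a q : C) : C := CLim_seq (qpoch a q).

Definition qpochs (l : list C) (q : C) (n : nat) : C :=
  fold_right (fun a p => qpoch a q n * p) 1 l.

Definition qpochs_inf (l : list C) (q : C) : C :=
  fold_right (fun a p => qpoch_inf a q * p) 1 l.

(* Basic hypergeometric series r-phi-s, with r = length a and s = length b.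
   Since 0 / 0 = 0, a factor vanishing in the numerator from some index on
   terminates the series, whatever happens to the denominator afterwards. *)
Definition bhs (a b : list C) (q z : C) : C :=
  CSeries (fun k =>
    qpochs a q k / qpochs (q :: b) q k
    * Cpowz ((- (1)) ^ k * q ^ (k * (k - 1) / 2)%nat)
        (1 + Z.of_nat (length b) - Z.of_nat (length a))
    * z ^ k).

(* Continuous q-ultraspherical (Rogers) polynomial C_n(x;beta|q); the angle
   theta with x = cos theta is taken in [0, PI]. *)
Definition rogers (n : nat) (x : R) (beta q : C) : C :=
  let theta := acos x in
  qpoch beta q n / qpoch q q n * expi (INR n * theta)
  * bhs [Cpowz q (- Z.of_nat n); beta]
        [/ beta * Cpowz q (1 - Z.of_nat n)]
        q (q * / beta * expi (- (2 * theta))).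

Definition rogers_weight (x : R) (gamma q : C) : R :=
  let theta := acos x in
  (Cmod (qpoch_inf (expi (2 * theta)) q
         / qpoch_inf (gamma * expi (2 * theta)) q) ^ 2)%R.

(* Main.v *)
(* Write [C_m(b)] for the Rogers polynomials of parameter [b], [w] for the weight of parameter [g].
   The product [(t b e, t b / e; q)_oo / (t e, t / e; q)_oo], [e = e^(i theta)], is the generating
   function [sum_m C_m(b) t^m], so it suffices to know [D(m, n) = int C_m(b) C_n(g) w] and to
   integrate termwise. The three-term recurrences of both families give one recurrence for [D],
   which determines [D] from [D(0, .)], and also from [D(., 0)]. An explicit expression satisfies
   it, so only initial values are needed. For [b = q] (Chebyshev polynomials of the second kind)
   [D(., 0)] comes from the Fourier coefficients of [w], which obey a first-order q-recurrence;
   this yields [D(0, .)], which does not depend on [b]. The total mass of [w] is found by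
   comparing the parameters [g] and [q g], which carries every [g] to the common limit [0] and
   so reduces to [g = q]. *)

Require Import Defs.
From Stdlib Require Import Reals ZArith List.
From Coquelicot Require Import Coquelicot.
From Stdlib Require Import Lra Lia.
Import ListNotations.

Open Scope R_scope.

(** * Coefficients of the q-binomial series *)

(* Coquelicot's lemmas leave equalities at the carrier of a structure, where [ring] fails. *)
Ltac as_R := match goal with |- ?x = ?y => change (@eq R x y); cbv beta end.

(* Coefficients of [sum_k qb q x b k z^k = (b z; q)_oo / (x z; q)_oo], homogeneous in [(x, b)]. *)
Fixpoint qb (q x b : R) (k : nat) : R :=
  match k with
  | O => 1
  | S j => qb q x b j * (x - b * q ^ j) / (1 - q ^ S j)
  end.

Fixpoint rpoch (a q : R) (n : nat) : R :=
  match n with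
  | O => 1
  | S m => rpoch a q m * (1 - a * q ^ m)
  end.

Lemma Rabs_pow_le_1 (q : R) (k : nat) : Rabs q < 1 -> Rabs (q ^ k) <= 1.
Proof.
  intros H; rewrite <- RPow_abs, <- (pow1 k).
  apply pow_incr; split; [apply Rabs_pos | lra].
Qed.

Lemma one_minus_pos (a q : R) (k : nat) :
  Rabs q < 1 -> Rabs a < 1 -> 0 < 1 - a * q ^ k.
Proof.
  intros Hq Ha.
  assert (H := Rabs_pow_le_1 q k Hq).
  assert (H1 : Rabs (a * q ^ k) < 1).
  { rewrite Rabs_mult; assert (H0 := Rabs_pos a); assert (H2 := Rabs_pos (q ^ k)); nra. }
  apply Rabs_def2 in H1; lra.
Qed.

Lemma one_minus_pow_pos (q : R) (k : nat) : Rabs q < 1 -> 0 < 1 - q ^ S k.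
Proof. intros Hq; simpl; exact (one_minus_pos q q k Hq Hq). Qed.

Lemma qb_S (q x b : R) (k : nat) : Rabs q < 1 ->
  qb q x b (S k) * (1 - q ^ S k) = qb q x b k * (x - b * q ^ k).
Proof.
  intros Hq; assert (H := one_minus_pow_pos q k Hq); simpl in *; field; lra.
Qed.

Lemma rpoch_neq_0 (a q : R) (n : nat) : Rabs q < 1 -> Rabs a < 1 -> rpoch a q n <> 0.
Proof.
  intros Hq Ha; induction n as [|n IH]; simpl; [lra|].
  apply Rmult_integral_contrapositive; split; [assumption|].
  assert (H := one_minus_pos a q n Hq Ha); lra.
Qed.

Lemma sum_geom_le (r : R) (n : nat) : 0 <= r < 1 -> sum_n (fun j => r ^ j) n <= / (1 - r).
Proof.
  intros Hr; rewrite sum_n_Reals, tech3 by lra.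
  assert (H := pow_le r (S n) (proj1 Hr)).
  unfold Rdiv; rewrite <- (Rmult_1_l (/ (1 - r))) at 2.
  apply Rmult_le_compat_r; [apply Rlt_le, Rinv_0_lt_compat|]; lra.
Qed.

Lemma exp_le (x y : R) : x <= y -> exp x <= exp y.
Proof. intros [H| ->]; [left; apply exp_increasing, H | lra]. Qed.

Lemma prod_exp_bound (f : nat -> R) (r c : R) :
  0 <= r < 1 -> 0 <= c ->
  f O = 1 -> (forall j, 0 <= f j) -> (forall j, f (S j) <= f j * exp (c * r ^ j)) ->
  forall n, f n <= exp (c / (1 - r)).
Proof.
  intros Hr Hc H0 Hp HS n.
  assert (Hi : 0 < / (1 - r)) by (apply Rinv_0_lt_compat; lra).
  destruct n as [|n].
  { rewrite H0; rewrite <- exp_0 at 1; apply exp_le, Rmult_le_pos; lra. }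
  apply Rle_trans with (exp (c * sum_n (fun j => r ^ j) n)).
  - induction n as [|n IH].
    + rewrite sum_O; specialize (HS O); rewrite H0 in HS; lra.
    + rewrite sum_Sn; change plus with Rplus.
      rewrite Rmult_plus_distr_l, exp_plus.
      eapply Rle_trans; [apply HS|].
      apply Rmult_le_compat_r; [left; apply exp_pos | exact IH].
  - apply exp_le; unfold Rdiv; apply Rmult_le_compat_l; [lra | apply sum_geom_le, Hr].
Qed.

Lemma inv_one_minus_le (y r : R) : 0 <= y <= r -> r < 1 -> / (1 - y) <= exp (y / (1 - r)).
Proof.
  intros Hy Hr.
  apply Rle_trans with (1 + y / (1 - y)).
  - right; field; lra.
  - eapply Rle_trans; [apply exp_ineq1_le|]; apply exp_le.
    unfold Rdiv; apply Rmult_le_compat_l; [lra|]; apply Rinv_le_contravar; lra.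
Qed.

Lemma qb_bound (q b r : R) : Rabs q < 1 -> 0 < r ->
  exists M, 0 < M /\ forall x k, Rabs x <= r -> Rabs (qb q x b k) <= M * r ^ k.
Proof.
  intros Hq Hr.
  set (c := Rabs b / r + / (1 - Rabs q)).
  assert (Hq0 := Rabs_pos q).
  assert (Hi : 0 < / (1 - Rabs q)) by (apply Rinv_0_lt_compat; lra).
  assert (Hir : 0 < / r) by (apply Rinv_0_lt_compat; lra).
  assert (Hb : 0 <= Rabs b / r) by (apply Rmult_le_pos; [apply Rabs_pos | lra]).
  exists (exp (c / (1 - Rabs q))); split; [apply exp_pos|].
  intros x k Hx.
  assert (Hrk : forall j, 0 < r ^ j) by (intros; apply pow_lt, Hr).
  assert (H : forall n, Rabs (qb q x b n) / r ^ n <= exp (c / (1 - Rabs q))).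
  { apply prod_exp_bound; unfold c; try lra.
    - simpl; rewrite Rabs_R1; field.
    - intros j; apply Rmult_le_pos; [apply Rabs_pos | left; apply Rinv_0_lt_compat, Hrk].
    - intros j.
      assert (Hqj : 0 <= Rabs q ^ j <= 1).
      { split; [apply pow_le, Hq0|]; rewrite RPow_abs; apply Rabs_pow_le_1, Hq. }
      assert (Hden := one_minus_pow_pos q j Hq).
      replace (Rabs (qb q x b (S j)) / r ^ S j)
        with (Rabs (qb q x b j) / r ^ j * ((Rabs (x - b * q ^ j) / r) * / (1 - q ^ S j)))
        by (cbn [qb]; unfold Rdiv; rewrite !Rabs_mult, (Rabs_inv (1 - q ^ S j)), (Rabs_pos_eq (1 - q ^ S j)) by lra;
            cbn [pow] in Hden |- *; field; repeat split; try lra; specialize (Hrk j); lra).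
      apply Rmult_le_compat_l.
      { apply Rmult_le_pos; [apply Rabs_pos | left; apply Rinv_0_lt_compat, Hrk]. }
      rewrite Rmult_plus_distr_r, exp_plus.
      apply Rmult_le_compat.
      + apply Rmult_le_pos; [apply Rabs_pos | lra].
      + left; apply Rinv_0_lt_compat; lra.
      + apply Rle_trans with (1 + Rabs b / r * Rabs q ^ j); [|apply exp_ineq1_le].
        apply Rmult_le_reg_r with r; [lra|].
        replace ((1 + Rabs b / r * Rabs q ^ j) * r) with (r + Rabs b * Rabs q ^ j) by (field; lra).
        replace (Rabs (x - b * q ^ j) / r * r) with (Rabs (x - b * q ^ j)) by (field; lra).
        unfold Rminus; eapply Rle_trans; [apply Rabs_triang|].
        rewrite Rabs_Ropp, Rabs_mult, <- RPow_abs; lra.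
      + assert (Hle : q ^ S j <= Rabs q ^ S j) by (rewrite RPow_abs; apply Rle_abs).
        assert (Hs : Rabs q ^ S j <= Rabs q) by (cbn [pow]; nra).
        assert (Hs0 : Rabs q ^ S j <= Rabs q ^ j) by (cbn [pow]; nra).
        apply Rle_trans with (/ (1 - Rabs q ^ S j)).
        { apply Rinv_le_contravar; lra. }
        eapply Rle_trans; [apply (inv_one_minus_le _ (Rabs q)); [split; [apply pow_le, Hq0 | exact Hs] | exact Hq]|].
        apply exp_le; unfold Rdiv; rewrite (Rmult_comm (Rabs q ^ S j)); apply Rmult_le_compat_l; lra. }
  specialize (H k); apply Rmult_le_reg_r with (/ r ^ k); [apply Rinv_0_lt_compat, Hrk|].
  rewrite Rmult_assoc, Rinv_r, Rmult_1_r; [exact H | apply Rgt_not_eq, Hrk].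
Qed.

Lemma ex_series_scal_geom (M r : R) : Rabs r < 1 -> ex_series (fun k => M * r ^ k).
Proof. intros Hr; apply (ex_series_scal (V := R_NormedModule) M (fun k => r ^ k)), ex_series_geom, Hr. Qed.

Lemma is_series_Rscal (c : R) (a : nat -> R) (l : R) :
  is_series a l -> is_series (fun k => c * a k) (c * l).
Proof. exact (is_series_scal (V := R_NormedModule) c a l). Qed.

Lemma is_series_Rminus (a b : nat -> R) (la lb : R) :
  is_series a la -> is_series b lb -> is_series (fun k => a k - b k) (la - lb).
Proof. exact (is_series_minus (V := R_NormedModule) a b la lb). Qed.

Lemma is_series_telescope (G : nat -> R) :
  is_lim_seq G 0 -> is_series (fun k => G (S k) - G k) (- G O).
Proof.
  intros H; change (is_lim_seq (sum_n (fun k => G (S k) - G k)) (Finite (- G O))).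
  apply is_lim_seq_ext with (fun n => G (S n) - G O).
  - intros n; induction n as [|n IH]; [rewrite sum_O; reflexivity|].
    rewrite sum_Sn, <- IH; change plus with Rplus; simpl; ring.
  - replace (- G O) with (0 - G O) by ring.
    apply is_lim_seq_minus'; [apply -> is_lim_seq_incr_1; exact H | apply is_lim_seq_const].
Qed.

(* Fourier coefficients of the weight [|sum_k qb q g 1 k e^(2 i k theta)|^2]. *)
Definition omega (q g : R) (m : nat) : R := Series (fun k => qb q g 1 k * qb q g 1 (k + m)).

Section Omega.
Context (q g : R) (Hq : 0 < Rabs q < 1) (Hg : Rabs g < 1).

Notation a := (qb q g 1).

Lemma qb_lt_1_bound : exists M r, 0 < M /\ 0 < r < 1 /\ forall k, Rabs (a k) <= M * r ^ k.
Proof.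
  set (r := (1 + Rabs g) / 2); assert (H0 := Rabs_pos g).
  destruct (qb_bound q 1 r (proj2 Hq)) as [M [HM H]]; [unfold r; lra|].
  exists M, r; split; [exact HM|]; split; [unfold r; lra|].
  intros k; apply H; unfold r; lra.
Qed.

Lemma ex_series_corr (m : nat) (c : nat -> R) (K : R) : (forall k, Rabs (c k) <= K) ->
  ex_series (fun k => a k * a (k + m)%nat * c k).
Proof.
  intros Hc; destruct qb_lt_1_bound as [M [r [HM [Hr H]]]].
  apply (ex_series_le (K := R_AbsRing) (V := R_CompleteNormedModule)) with (fun k => M * M * K * r ^ k).
  - intros k; change (norm ?x) with (Rabs x); rewrite !Rabs_mult.
    assert (Ha : Rabs (a (k + m)%nat) <= M).
    { eapply Rle_trans; [apply H|].
      assert (r ^ (k + m) <= 1) by (rewrite <- (pow1 (k + m)); apply pow_incr; lra); nra. }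
    replace (M * M * K * r ^ k) with (M * r ^ k * M * K) by ring.
    repeat apply Rmult_le_compat; auto using Rabs_pos.
    apply Rmult_le_pos; apply Rabs_pos.
  - apply ex_series_scal_geom; rewrite Rabs_pos_eq; lra.
Qed.

Lemma lim_corr (m : nat) (c : nat -> R) (K : R) : (forall k, Rabs (c k) <= K) ->
  is_lim_seq (fun k => a k * a (k + m)%nat * c k) 0.
Proof. intros Hc; apply ex_series_lim_0, (ex_series_corr m c K Hc). Qed.

Let v (m : nat) := Series (fun k => a k * a (k + m)%nat * q ^ k).

Lemma is_series_omega (m : nat) : is_series (fun k => a k * a (k + m)%nat) (omega q g m).
Proof.
  apply Series_correct.
  apply ex_series_ext with (fun k => a k * a (k + m)%nat * 1); [intros; apply Rmult_1_r|].
  apply ex_series_corr with 1; intros; rewrite Rabs_R1; lra.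
Qed.

Let is_series_v (m : nat) : is_series (fun k => a k * a (k + m)%nat * q ^ k) (v m).
Proof.
  apply Series_correct, ex_series_corr with 1; intros; apply Rabs_pow_le_1; lra.
Qed.

(* Both this relation and [omega_v_shift] are telescoping sums. Analytically they express the
   invariance of the contour integral of [(u, q/u; q)_oo / (g u, q g/u; q)_oo] under [u -> q u]. *)
Lemma omega_v (m : nat) : (1 + g) * omega q g m = (1 + q ^ m) * v m.
Proof.
  set (G := fun k => a k * a (k + m)%nat * ((1 - q ^ k) * (1 - q ^ (k + m)))).
  assert (HG : is_lim_seq G 0).
  { apply lim_corr with 4; intros k; rewrite Rabs_mult.
    assert (Hx : forall j, Rabs (1 - q ^ j) <= 2).
    { intros j; unfold Rminus; eapply Rle_trans; [apply Rabs_triang|].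
      rewrite Rabs_R1, Rabs_Ropp; assert (H := Rabs_pow_le_1 q j (proj2 Hq)); lra. }
    assert (H1 := Hx k); assert (H2 := Hx (k + m)%nat).
    assert (H3 := Rabs_pos (1 - q ^ k)); assert (H4 := Rabs_pos (1 - q ^ (k + m))); nra. }
  apply is_series_telescope in HG.
  assert (H1 : is_series (fun k => G (S k) - G k) ((1 - g) * ((1 + q ^ m) * v m - (1 + g) * omega q g m))).
  { eapply is_series_ext; [|apply (is_series_Rscal (1 - g)), is_series_Rminus;
      [apply (is_series_Rscal (1 + q ^ m)), (is_series_v m) | apply (is_series_Rscal (1 + g)), (is_series_omega m)]].
    intros k; as_R.
    unfold G; cbn [Nat.add].
    replace (a (S k) * a (S (k + m)) * ((1 - q ^ S k) * (1 - q ^ S (k + m))))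
      with ((a (S k) * (1 - q ^ S k)) * (a (S (k + m)) * (1 - q ^ S (k + m)))) by ring.
    rewrite !qb_S by lra; rewrite pow_add; ring. }
  apply is_series_unique in H1; apply is_series_unique in HG.
  assert (H2 : (1 - g) * ((1 + q ^ m) * v m - (1 + g) * omega q g m) = - G O) by (rewrite <- H1; exact HG).
  replace (- G O) with 0 in H2 by (unfold G; simpl; ring).
  assert (Hg' := Rabs_def2 _ _ Hg).
  apply Rmult_integral in H2; destruct H2; lra.
Qed.

Lemma omega_v_shift (m : nat) : omega q g m - v m = g * omega q g (S m) - v (S m).
Proof.
  set (G := fun k => a k * a (k + m)%nat * (1 - q ^ k)).
  assert (HG : is_lim_seq G 0).
  { apply lim_corr with 2; intros k; unfold Rminus; eapply Rle_trans; [apply Rabs_triang|].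
    rewrite Rabs_R1, Rabs_Ropp; assert (H := Rabs_pow_le_1 q k (proj2 Hq)); lra. }
  apply is_series_telescope in HG.
  assert (H1 : is_series (fun k => G (S k) - G k) (g * omega q g (S m) - v (S m) - (omega q g m - v m))).
  { eapply is_series_ext; [|apply is_series_Rminus; apply is_series_Rminus;
      [apply (is_series_Rscal g), (is_series_omega (S m)) | apply (is_series_v (S m)) |
       apply (is_series_omega m) | apply (is_series_v m)]].
    intros k; as_R.
    unfold G; cbn [Nat.add]; rewrite Nat.add_succ_r.
    replace (a (S k) * a (S (k + m)) * (1 - q ^ S k))
      with ((a (S k) * (1 - q ^ S k)) * a (S (k + m))) by ring.
    rewrite qb_S by lra; ring. }
  apply is_series_unique in H1; apply is_series_unique in HG.
  assert (H2 : g * omega q g (S m) - v (S m) - (omega q g m - v m) = - G O) by (rewrite <- H1; exact HG).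
  replace (- G O) with 0 in H2 by (unfold G; simpl; ring); lra.
Qed.

Lemma omega_S (m : nat) :
  omega q g (S m) * (1 - g * q ^ S m) * (1 + q ^ m) = omega q g m * (g - q ^ m) * (1 + q ^ S m).
Proof.
  assert (H0 := omega_v m); assert (H1 := omega_v (S m)); assert (H2 := omega_v_shift m).
  replace (v (S m)) with (v m - omega q g m + g * omega q g (S m)) in H1 by lra.
  transitivity ((1 + q ^ m) * ((1 + g) * omega q g (S m)) - (1 + q ^ m) * (1 + q ^ S m) * g * omega q g (S m)); [ring|].
  rewrite H1.
  transitivity ((1 + q ^ S m) * ((1 + q ^ m) * v m - (1 + q ^ m) * omega q g m)); [ring|].
  rewrite <- H0; ring.
Qed.

Lemma omega_closed (m : nat) : omega q g m * rpoch (g * q) q m * 2 =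
  omega q g O * (1 + q ^ m) * qb q g 1 m * rpoch q q m.
Proof.
  assert (Hgq : Rabs (g * q) < 1).
  { rewrite Rabs_mult; assert (H := Rabs_pos g); assert (H' := Rabs_pos q); nra. }
  induction m as [|m IH]; [simpl; ring|].
  assert (H := omega_S m).
  assert (Hm : 0 < 1 + q ^ m).
  { destruct m; [simpl; lra|].
    assert (Hm := one_minus_pos (- q) q m); rewrite Rabs_Ropp in Hm; simpl; specialize (Hm (proj2 Hq) (proj2 Hq)); lra. }
  apply Rmult_eq_reg_r with (1 + q ^ m); [|lra].
  assert (Hqb := qb_S q g 1 m (proj2 Hq)).
  cbn [rpoch].
  transitivity (rpoch (g * q) q m * 2 * (omega q g (S m) * (1 - g * q ^ S m) * (1 + q ^ m))); [cbn [pow]; ring|].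
  rewrite H.
  transitivity ((omega q g m * rpoch (g * q) q m * 2) * (g - q ^ m) * (1 + q ^ S m)); [ring|].
  rewrite IH.
  transitivity (omega q g O * (1 + q ^ m) * rpoch q q m * (1 + q ^ S m) * (qb q g 1 m * (g - 1 * q ^ m))); [ring|].
  rewrite <- Hqb; cbn [pow]; ring.
Qed.

Lemma omega_1 : omega q g 1 * (1 - g * q) * 2 = omega q g O * (g - 1) * (1 + q).
Proof. assert (H := omega_S O); simpl in H; lra. Qed.

End Omega.

(** * The recurrence for the mixed integrals *)

(* Lowering term of the three-term recurrence, with the convention [C_(-1) = 0]. *)
Definition lowered (b q : R) (f : nat -> R) (n : nat) : R :=
  match n with O => 0 | S p => (1 - b ^ 2 * q ^ p) * f p end.

(* Value of [int C_(n+2k)(.;b|q) C_n(.;g|q) w] when [h = int w]; integrals with other pairs of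
   indices vanish, see [dform]. *)
Definition conn (q b g h : R) (n k : nat) : R :=
  h * (rpoch (g ^ 2) q n / rpoch q q n)
  * (rpoch b q (n + k) / rpoch (g * q) q (n + k)) * qb q g b k.

Definition dform (q b g h : R) (m n : nat) : R :=
  if andb (n <=? m) (Nat.even (m - n)) then conn q b g h n ((m - n) / 2) else 0.

Lemma dform_conn (q b g h : R) (n k : nat) : dform q b g h (n + 2 * k) n = conn q b g h n k.
Proof.
  unfold dform.
  replace (n + 2 * k - n)%nat with (2 * k)%nat by lia.
  rewrite (proj2 (Nat.leb_le n (n + 2 * k))) by lia.
  rewrite Nat.even_even; simpl andb; cbv iota.
  rewrite Nat.mul_comm, Nat.div_mul by lia; reflexivity.
Qed.

Lemma dform_eq (q b g h : R) (m n k : nat) :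
  (m = n + 2 * k)%nat -> dform q b g h m n = conn q b g h n k.
Proof. intros ->; apply dform_conn. Qed.

Lemma dform_0 (q b g h : R) (m n : nat) :
  (forall k, m <> n + 2 * k)%nat -> dform q b g h m n = 0.
Proof.
  intros H; unfold dform.
  destruct (Nat.leb_spec n m) as [Hle|]; [|reflexivity].
  destruct (Nat.even (m - n)) eqn:E; [|reflexivity].
  apply Nat.even_spec in E; destruct E as [k Hk]; exfalso; apply (H k); lia.
Qed.

Section Recurrence.
Context (q b g h : R) (Hq : Rabs q < 1) (Hg : Rabs g < 1).

Let Hgq : Rabs (g * q) < 1.
Proof. rewrite Rabs_mult; assert (H0 := Rabs_pos g); assert (H1 := Rabs_pos q); nra. Qed.

Let rec_interior (n k : nat) :
  (1 - g * q ^ S n) * ((1 - q ^ (n + 2 * k + 3)) * conn q b g h (S n) (S k)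
      + (1 - b ^ 2 * q ^ (n + 2 * k + 1)) * conn q b g h (S n) k)
  = (1 - b * q ^ (n + 2 * k + 2)) * ((1 - q ^ S (S n)) * conn q b g h (S (S n)) k
      + (1 - g ^ 2 * q ^ n) * conn q b g h n (S k)).
Proof.
  assert (H1 := rpoch_neq_0 q q n Hq Hq).
  assert (H2 := rpoch_neq_0 (g * q) q (n + k) Hq Hgq).
  assert (H3 := one_minus_pos q q n Hq Hq).
  assert (H4 := one_minus_pos q q (S n) Hq Hq).
  assert (H5 := one_minus_pos q q k Hq Hq).
  assert (H6 := one_minus_pos (g * q) q (n + k) Hq Hgq).
  assert (H7 := one_minus_pos (g * q) q (S (n + k)) Hq Hgq).
  replace (n + 2 * k + 3)%nat with (S (S (S (n + k + k)))) by lia.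
  replace (n + 2 * k + 2)%nat with (S (S (n + k + k))) by lia.
  replace (n + 2 * k + 1)%nat with (S (n + k + k)) by lia.
  unfold conn; rewrite !Nat.add_succ_r, !Nat.add_succ_l; cbn [rpoch qb].
  cbn [pow] in *; rewrite !pow_add in *.
  field; repeat split; lra.
Qed.

Let rec_0_l (n : nat) :
  (1 - g * q ^ S n) * (1 - q ^ S n) * conn q b g h (S n) 0
  = (1 - b * q ^ n) * (1 - g ^ 2 * q ^ n) * conn q b g h n 0.
Proof.
  assert (H1 := rpoch_neq_0 q q n Hq Hq).
  assert (H2 := rpoch_neq_0 (g * q) q n Hq Hgq).
  assert (H3 := one_minus_pos q q n Hq Hq).
  assert (H4 := one_minus_pos (g * q) q n Hq Hgq).
  unfold conn; rewrite !Nat.add_0_r; cbn [rpoch qb pow] in *.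
  field; repeat split; lra.
Qed.

Let rec_0_r (k : nat) :
  (1 - g) * ((1 - q ^ (2 * k + 2)) * conn q b g h 0 (S k)
      + (1 - b ^ 2 * q ^ (2 * k)) * conn q b g h 0 k)
  = (1 - b * q ^ (2 * k + 1)) * ((1 - q) * conn q b g h 1 k).
Proof.
  assert (H2 := rpoch_neq_0 (g * q) q k Hq Hgq).
  assert (H3 := one_minus_pos q q 0 Hq Hq).
  assert (H5 := one_minus_pos q q k Hq Hq).
  assert (H6 := one_minus_pos (g * q) q k Hq Hgq).
  replace (2 * k + 2)%nat with (S (S (k + k))) by lia.
  replace (2 * k + 1)%nat with (S (k + k)) by lia.
  replace (2 * k)%nat with (k + k)%nat by lia.
  unfold conn; cbn [Nat.add rpoch qb].
  cbn [pow] in *; rewrite !pow_add in *.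
  field; repeat split; lra.
Qed.

Lemma dform_rec (m n : nat) :
  (1 - g * q ^ n) * ((1 - q ^ S m) * dform q b g h (S m) n
      + lowered b q (fun i => dform q b g h i n) m)
  = (1 - b * q ^ m) * ((1 - q ^ S n) * dform q b g h m (S n)
      + lowered g q (fun j => dform q b g h m j) n).
Proof.
  assert (Hcase : (exists k, S m = n + 2 * k)%nat \/ (forall k, S m <> n + 2 * k)%nat).
  { destruct (Nat.le_gt_cases n (S m)) as [Hle|Hlt]; [|right; intros; lia].
    destruct (Nat.Even_or_Odd (S m - n)) as [[k Hk]|[k Hk]]; [left; exists k; lia | right; intros j; lia]. }
  destruct Hcase as [[k Hk]|Hno].
  - destruct k as [|k].
    + destruct n as [|n]; [lia|]; assert (Hm : m = n) by lia; subst m.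
      unfold lowered at 2.
      rewrite (dform_eq _ _ _ _ (S n) (S n) 0), (dform_eq _ _ _ _ n n 0), (dform_0 _ _ _ _ n (S (S n))) by lia.
      replace (lowered _ _ _ _) with 0 by (destruct n; simpl; [|rewrite dform_0 by lia]; ring).
      assert (H := rec_0_l n); lra.
    + rewrite (dform_eq _ _ _ _ (S m) n (S k)), (dform_eq _ _ _ _ m (S n) k) by lia.
      destruct m as [|m]; [lia|].
      unfold lowered at 1; rewrite (dform_eq _ _ _ _ m n k) by lia.
      destruct n as [|n].
      * simpl lowered; assert (H := rec_0_r k).
        replace (S (S m)) with (2 * k + 2)%nat by lia.
        replace (S m) with (2 * k + 1)%nat by lia.
        replace m with (2 * k)%nat by lia.
        rewrite pow_1, pow_O; lra.
      * unfold lowered; rewrite (dform_eq _ _ _ _ (S m) n (S k)) by lia.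
        assert (H := rec_interior n k).
        replace (S (S m)) with (n + 2 * k + 3)%nat by lia.
        replace (S m) with (n + 2 * k + 2)%nat by lia.
        replace m with (n + 2 * k + 1)%nat by lia.
        exact H.
  - rewrite (dform_0 _ _ _ _ (S m) n) by exact Hno.
    rewrite (dform_0 _ _ _ _ m (S n)) by (intros k Hk; apply (Hno (S k)); lia).
    replace (lowered b q _ m) with 0.
    + replace (lowered g q _ n) with 0; [ring|].
      destruct n as [|n]; [reflexivity|]; unfold lowered.
      rewrite dform_0; [ring|]; intros k Hk; apply (Hno k); lia.
    + destruct m as [|m]; [reflexivity|]; unfold lowered.
      rewrite dform_0; [ring|]; intros k Hk; apply (Hno (S k)); lia.
Qed.

End Recurrence.

Section Uniqueness.
Context (q b g : R) (Hq : Rabs q < 1) (Hg : Rabs g < 1) (D D' : nat -> nat -> R).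

Definition connection_rec (D : nat -> nat -> R) := forall m n,
  (1 - g * q ^ n) * ((1 - q ^ S m) * D (S m) n + lowered b q (fun i => D i n) m)
  = (1 - b * q ^ m) * ((1 - q ^ S n) * D m (S n) + lowered g q (fun j => D m j) n).

Context (HD : connection_rec D) (HD' : connection_rec D').

Lemma connection_rec_unique_l : (forall n, D 0%nat n = D' 0%nat n) -> forall m n, D m n = D' m n.
Proof.
  intros H0; assert (H : forall m, (forall n, D m n = D' m n) /\ (forall n, D (S m) n = D' (S m) n)).
  { assert (Hs : forall m, (forall n, D m n = D' m n) ->
      (forall n, lowered b q (fun i => D i n) m = lowered b q (fun i => D' i n) m) ->
      forall n, D (S m) n = D' (S m) n).
    { intros m H Hl n; assert (E := HD m n); assert (E' := HD' m n).
      assert (Hlg : lowered g q (fun j => D m j) n = lowered g q (fun j => D' m j) n)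
        by (destruct n; simpl; rewrite ?H; reflexivity).
      rewrite H, Hlg, <- E', Hl in E.
      assert (P1 := one_minus_pos g q n Hq Hg); assert (P2 := one_minus_pow_pos q m Hq).
      apply Rmult_eq_reg_l in E; [|lra].
      apply Rplus_eq_reg_r, Rmult_eq_reg_l in E; [exact E | lra]. }
    intros m; induction m as [|m [IH1 IH2]].
    - split; [exact H0|]; apply Hs; [exact H0 | reflexivity].
    - split; [exact IH2|]; apply Hs; [exact IH2|]; intros n; simpl; rewrite IH1; reflexivity. }
  intros m; apply H.
Qed.

End Uniqueness.

Lemma connection_rec_sym (q b g : R) (D : nat -> nat -> R) :
  connection_rec q b g D -> connection_rec q g b (fun m n => D n m).
Proof. intros H m n; symmetry; apply H. Qed.

Lemma connection_rec_unique_r (q b g : R) (D D' : nat -> nat -> R) :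
  Rabs q < 1 -> Rabs b < 1 -> connection_rec q b g D -> connection_rec q b g D' ->
  (forall m, D m 0%nat = D' m 0%nat) -> forall m n, D m n = D' m n.
Proof.
  intros Hq Hb HD HD' H0 m n.
  exact (connection_rec_unique_l q g b Hq Hb _ _ (connection_rec_sym _ _ _ _ HD)
    (connection_rec_sym _ _ _ _ HD') H0 n m).
Qed.

(** * Termwise integration and Fourier coefficients of the weight *)

Lemma series_tail (u M : nat -> R) (n : nat) :
  (forall k, Rabs (u k) <= M k) -> ex_series M ->
  Rabs (Series u - sum_n u n) <= Series M - sum_n M n.
Proof.
  intros Hu HM.
  assert (Hau : ex_series (fun k => Rabs (u k))).
  { apply (ex_series_le (K := R_AbsRing) (V := R_CompleteNormedModule)) with M; [|exact HM].
    intros k; change (norm ?x) with (Rabs x); rewrite Rabs_Rabsolu; apply Hu. }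
  assert (Heu : ex_series u) by apply ex_series_Rabs, Hau.
  rewrite (Series_incr_n u (S n)), (Series_incr_n M (S n)) by (auto; lia).
  rewrite !sum_n_Reals; simpl Init.Nat.pred.
  replace (sum_f_R0 u n + _ - sum_f_R0 u n) with (Series (fun k => u (S n + k)%nat)) by ring.
  replace (sum_f_R0 M n + _ - sum_f_R0 M n) with (Series (fun k => M (S n + k)%nat)) by ring.
  eapply Rle_trans; [apply Series_Rabs|].
  - apply -> (ex_series_incr_n (fun k => Rabs (u k)) (S n)); exact Hau.
  - apply Series_le.
    + intros k; split; [apply Rabs_pos | apply Hu].
    + apply -> (ex_series_incr_n M (S n)); exact HM.
Qed.

Lemma lim_tail (M : nat -> R) : ex_series M -> is_lim_seq (fun n => Series M - sum_n M n) 0.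
Proof.
  intros HM; replace 0 with (Series M - Series M) by ring.
  apply is_lim_seq_minus'; [apply is_lim_seq_const | exact (Series_correct M HM)].
Qed.

Lemma continuous_sum_n (f : nat -> R -> R) (x : R) (n : nat) :
  (forall k, continuous (f k) x) -> continuous (fun y => sum_n (fun k => f k y) n) x.
Proof.
  intros H; induction n as [|n IH].
  - apply continuous_ext with (f O); [intros; rewrite sum_O; reflexivity | apply H].
  - apply continuous_ext with (fun y => plus (sum_n (fun k => f k y) n) (f (S n) y)).
    { intros; rewrite sum_Sn; reflexivity. }
    apply (continuous_plus (K := R_AbsRing) (V := R_NormedModule)); [exact IH | apply H].
Qed.

Lemma continuous_Series (f : nat -> R -> R) (M : nat -> R) (x : R) :
  (forall k, continuous (f k) x) -> locally x (fun y => forall k, Rabs (f k y) <= M k) ->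
  ex_series M -> continuous (fun y => Series (fun k => f k y)) x.
Proof.
  intros Hf HM HeM.
  apply filterlim_locally; intros eps.
  assert (He : 0 < eps / 3) by (assert (H := cond_pos eps); lra).
  assert (Ht := proj2 (is_lim_seq_spec _ _) (lim_tail M HeM) (mkposreal _ He)).
  destruct Ht as [n Hn]; specialize (Hn n (le_n n)); simpl in Hn; rewrite Rminus_0_r in Hn.
  assert (Hc := proj1 (filterlim_locally _ _) (continuous_sum_n f x n Hf) (mkposreal _ He)).
  assert (HMx := locally_singleton _ _ HM).
  generalize (filter_and _ _ HM Hc); apply filter_imp; intros y [Hy Hyc].
  assert (T1 := series_tail (fun k => f k y) M n Hy HeM).
  assert (T2 := series_tail (fun k => f k x) M n HMx HeM).
  assert (Hyc' : Rabs (sum_n (fun k => f k y) n - sum_n (fun k => f k x) n) < eps / 3) by exact Hyc.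
  change (Rabs (Series (fun k => f k y) - Series (fun k => f k x)) < eps).
  apply Rabs_def2 in Hn; apply Rabs_def2 in Hyc'.
  apply Rabs_le_between in T1; apply Rabs_le_between in T2.
  apply Rabs_def1; lra.
Qed.

Lemma is_series_RInt (f : nat -> R -> R) (M : nat -> R) (a b : R) :
  a <= b -> (forall k x, continuous (f k) x) -> (forall k x, Rabs (f k x) <= M k) ->
  ex_series M -> is_series (fun k => RInt (f k) a b) (RInt (fun x => Series (fun k => f k x)) a b).
Proof.
  intros Hab Hf HM HeM.
  assert (HF : forall x, continuous (fun y => Series (fun k => f k y)) x).
  { intros x; apply continuous_Series with M; auto; apply filter_forall; auto. }
  assert (Hs : forall n, RInt (fun x => sum_n (fun k => f k x) n) a b = sum_n (fun k => RInt (f k) a b) n).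
  { intros n; induction n as [|n IH].
    - rewrite sum_O; apply RInt_ext; intros; rewrite sum_O; reflexivity.
    - rewrite sum_Sn, <- IH, <- (RInt_plus (V := R_CompleteNormedModule)).
      + apply RInt_ext; intros; rewrite sum_Sn; reflexivity.
      + apply (ex_RInt_continuous (V := R_CompleteNormedModule)); intros; apply continuous_sum_n; auto.
      + apply (ex_RInt_continuous (V := R_CompleteNormedModule)); auto. }
  set (I := RInt (fun x => Series (fun k => f k x)) a b).
  change (is_lim_seq (sum_n (fun k => RInt (f k) a b)) I).
  assert (HL : is_lim_seq (fun n => (b - a) * (Series M - sum_n M n)) 0).
  { replace (Finite 0) with (Rbar_mult (b - a) 0) by (simpl; f_equal; ring).
    apply is_lim_seq_scal_l, lim_tail, HeM. }
  apply is_lim_seq_le_le with (u := fun n => I - (b - a) * (Series M - sum_n M n))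
    (w := fun n => I + (b - a) * (Series M - sum_n M n)).
  - intros n; rewrite <- Hs.
    assert (H : Rabs (I - RInt (fun x => sum_n (fun k => f k x) n) a b) <= (b - a) * (Series M - sum_n M n)).
    { unfold I; rewrite <- (RInt_minus (V := R_CompleteNormedModule)).
      - apply abs_RInt_le_const; [exact Hab| |].
        + apply (ex_RInt_continuous (V := R_CompleteNormedModule)); intros.
          apply (continuous_minus (V := R_NormedModule)); [apply HF | apply continuous_sum_n; auto].
        + intros x _; apply (series_tail (fun k => f k x)); auto.
      - apply (ex_RInt_continuous (V := R_CompleteNormedModule)); intros; apply HF.
      - apply (ex_RInt_continuous (V := R_CompleteNormedModule)); intros; apply continuous_sum_n; auto. }
    apply Rabs_le_between in H; lra.
  - replace (Finite I) with (Finite (I - 0)) by (f_equal; ring).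
    apply is_lim_seq_minus'; [apply is_lim_seq_const | exact HL].
  - replace (Finite I) with (Finite (I + 0)) by (f_equal; ring).
    apply is_lim_seq_plus'; [apply is_lim_seq_const | exact HL].
Qed.

Lemma continuous_cos_mult (c x : R) : continuous (fun y => cos (c * y)) x.
Proof. apply (ex_derive_continuous (K := R_AbsRing) (V := R_NormedModule)); auto_derive; trivial. Qed.

Lemma continuous_sin_mult (c x : R) : continuous (fun y => sin (c * y)) x.
Proof. apply (ex_derive_continuous (K := R_AbsRing) (V := R_NormedModule)); auto_derive; trivial. Qed.

Lemma ex_RInt_cont (f : R -> R) (a b : R) : (forall x, continuous f x) -> ex_RInt f a b.
Proof. intros H; apply (ex_RInt_continuous (V := R_CompleteNormedModule)); auto. Qed.

Lemma continuous_Rmult (f g : R -> R) (x : R) :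
  continuous f x -> continuous g x -> continuous (fun y => f y * g y) x.
Proof. exact (continuous_mult (K := R_AbsRing) f g x). Qed.

Lemma continuous_Rplus (f g : R -> R) (x : R) :
  continuous f x -> continuous g x -> continuous (fun y => f y + g y) x.
Proof. exact (continuous_plus (V := R_NormedModule) f g x). Qed.

Lemma RInt_Rscal (c : R) (f : R -> R) (a b : R) :
  (forall x, continuous f x) -> RInt (fun x => c * f x) a b = c * RInt f a b.
Proof. intros H; apply (RInt_scal (V := R_CompleteNormedModule)), ex_RInt_cont, H. Qed.

Lemma RInt_Rplus (f g : R -> R) (a b : R) :
  (forall x, continuous f x) -> (forall x, continuous g x) ->
  RInt (fun x => f x + g x) a b = RInt f a b + RInt g a b.
Proof. intros H1 H2; apply (RInt_plus (V := R_CompleteNormedModule)); apply ex_RInt_cont; assumption. Qed.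

Lemma RInt_cos_IZR (p : Z) : RInt (fun x => cos (IZR p * x)) 0 PI = if Z.eqb p 0 then PI else 0.
Proof.
  destruct (Z.eqb_spec p 0) as [->|Hp].
  - rewrite (RInt_ext _ (fun _ => 1)).
    + rewrite RInt_const; change scal with Rmult; simpl; ring.
    + intros; rewrite Rmult_0_l; apply cos_0.
  - assert (Hp' : IZR p <> 0) by (apply eq_IZR_contrapositive; exact Hp).
    apply is_RInt_unique.
    replace 0 with (minus (sin (IZR p * PI) / IZR p) (sin (IZR p * 0) / IZR p)) at 2.
    + apply (is_RInt_derive (V := R_CompleteNormedModule) (fun x => sin (IZR p * x) / IZR p)).
      * intros x _; auto_derive; trivial; field; exact Hp'.
      * intros x _; apply continuous_cos_mult.
    + rewrite (sin_eq_0_1 (IZR p * PI)) by (exists p; reflexivity).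
      rewrite Rmult_0_r, sin_0; change minus with Rminus; simpl; field; exact Hp'.
Qed.

Lemma cos_mult_cos (x y : R) : cos x * cos y = / 2 * (cos (x + y) + cos (x - y)).
Proof. rewrite cos_plus, cos_minus; field. Qed.

Lemma RInt_cos_cos (i j : Z) :
  RInt (fun x => cos (IZR i * x) * cos (IZR j * x)) 0 PI
  = / 2 * ((if Z.eqb (i + j) 0 then PI else 0) + (if Z.eqb (i - j) 0 then PI else 0)).
Proof.
  rewrite <- !RInt_cos_IZR, <- RInt_Rplus, <- RInt_Rscal.
  - apply RInt_ext; intros x _; rewrite cos_mult_cos, plus_IZR, minus_IZR.
    do 2 f_equal; f_equal; ring.
  - intros; apply continuous_Rplus; apply continuous_cos_mult.
  - intros; apply continuous_cos_mult.
  - intros; apply continuous_cos_mult.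
Qed.

Lemma is_series_0 : is_series (fun _ : nat => 0) 0.
Proof.
  change (is_lim_seq (sum_n (fun _ : nat => 0)) 0).
  apply is_lim_seq_ext with (fun _ => 0); [|apply is_lim_seq_const].
  intros n; rewrite sum_n_const; ring.
Qed.

Lemma is_series_drop (u : nat -> R) (l : R) (m : nat) :
  (forall k, (k < m)%nat -> u k = 0) -> is_series (fun k => u (m + k)%nat) l -> is_series u l.
Proof.
  revert u; induction m as [|m IH]; intros u Hu H; [exact H|].
  apply is_series_decr_1.
  evar_last; [apply (IH (fun k => u (S k))); [intros k Hk; apply Hu; lia | exact H]|].
  rewrite (Hu O) by lia; change (l = l + - 0); ring.
Qed.

Lemma is_series_single (u : nat -> R) (p : nat) :
  (forall k, k <> p -> u k = 0) -> is_series u (u p).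
Proof.
  intros Hu; apply is_series_drop with p; [intros; apply Hu; lia|].
  apply is_series_decr_1.
  rewrite Nat.add_0_r; apply is_series_ext with (fun _ => 0); [intros; symmetry; apply Hu; lia|].
  evar_last; [apply is_series_0 | change (0 = u p + - u p); ring].
Qed.

Lemma is_series_Rplus (a b : nat -> R) (la lb : R) :
  is_series a la -> is_series b lb -> is_series (fun k => a k + b k) (la + lb).
Proof. exact (is_series_plus (V := R_NormedModule) a b la lb). Qed.

Definition wre (q g x : R) : R := Series (fun k => qb q g 1 k * cos (INR (2 * k) * x)).
Definition wim (q g x : R) : R := Series (fun k => qb q g 1 k * sin (INR (2 * k) * x)).
Definition wt (q g x : R) : R := wre q g x ^ 2 + wim q g x ^ 2.

Section Weight.
Context (q g : R) (Hq : 0 < Rabs q < 1) (Hg : Rabs g < 1).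

Notation a := (qb q g 1).

Lemma trig_series_bound (f : nat -> R -> R) : (forall k x, Rabs (f k x) <= 1) ->
  exists M, ex_series M /\ forall k x, Rabs (a k * f k x) <= M k.
Proof.
  intros Hf; destruct (qb_lt_1_bound q g Hq Hg) as [M [r [HM [Hr H]]]].
  exists (fun k => M * r ^ k); split; [apply ex_series_scal_geom; rewrite Rabs_pos_eq; lra|].
  intros k x; rewrite Rabs_mult, <- (Rmult_1_r (M * r ^ k)).
  apply Rmult_le_compat; auto using Rabs_pos.
Qed.

Lemma ex_trig_series (f : nat -> R) : (forall k, Rabs (f k) <= 1) ->
  ex_series (fun k => a k * f k).
Proof.
  intros Hf; destruct (trig_series_bound (fun k _ => f k)) as [M [HM H]]; [auto|].
  apply (ex_series_le (K := R_AbsRing) (V := R_CompleteNormedModule)) with M; [|exact HM].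
  intros k; exact (H k 0).
Qed.

Lemma Rabs_cos (x : R) : Rabs (cos x) <= 1.
Proof. apply Rabs_le, COS_bound. Qed.

Lemma Rabs_sin (x : R) : Rabs (sin x) <= 1.
Proof. apply Rabs_le, SIN_bound. Qed.

Lemma continuous_trig_series (f : nat -> R -> R) (x : R) :
  (forall k y, Rabs (f k y) <= 1) -> (forall k, continuous (f k) x) ->
  continuous (fun y => Series (fun k => a k * f k y)) x.
Proof.
  intros Hf Hc; destruct (trig_series_bound f Hf) as [M [HM H]].
  apply continuous_Series with M; [|apply filter_forall; auto | exact HM].
  intros k; apply continuous_Rmult; [apply continuous_const | apply Hc].
Qed.

Lemma continuous_wt (x : R) : continuous (wt q g) x.
Proof.
  assert (H1 : continuous (wre q g) x).
  { apply continuous_trig_series; [intros; apply Rabs_cos | intros; apply continuous_cos_mult]. }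
  assert (H2 : continuous (wim q g) x).
  { apply continuous_trig_series; [intros; apply Rabs_sin | intros; apply continuous_sin_mult]. }
  apply continuous_ext with (fun y => wre q g y * wre q g y + wim q g y * wim q g y);
    [intros; unfold wt; as_R; ring|].
  apply continuous_Rplus; apply continuous_Rmult; assumption.
Qed.

Definition wshift (k : nat) (x : R) : R :=
  Series (fun l => a l * cos (IZR (2 * (Z.of_nat k - Z.of_nat l)) * x)).

Let wshift_eq (k : nat) (x : R) :
  wshift k x = cos (INR (2 * k) * x) * wre q g x + sin (INR (2 * k) * x) * wim q g x.
Proof.
  unfold wre, wim; rewrite <- !Series_scal_l, <- Series_plus.
  - apply Series_ext; intros l.
    replace (IZR (2 * (Z.of_nat k - Z.of_nat l)) * x) with (INR (2 * k) * x - INR (2 * l) * x).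
    + rewrite cos_minus; ring.
    + rewrite !INR_IZR_INZ, <- Rmult_minus_distr_r, <- minus_IZR; f_equal; f_equal; lia.
  - apply (ex_series_scal (V := R_NormedModule)), ex_trig_series; intros; apply Rabs_cos.
  - apply (ex_series_scal (V := R_NormedModule)), ex_trig_series; intros; apply Rabs_sin.
Qed.

Let wt_series (x : R) : wt q g x = Series (fun k => a k * wshift k x).
Proof.
  unfold wt; symmetry.
  rewrite (Series_ext _ (fun k => wre q g x * (a k * cos (INR (2 * k) * x)) + wim q g x * (a k * sin (INR (2 * k) * x)))).
  - rewrite Series_plus, !Series_scal_l.
    + unfold wre, wim; ring.
    + apply (ex_series_scal (V := R_NormedModule)), ex_trig_series; intros; apply Rabs_cos.
    + apply (ex_series_scal (V := R_NormedModule)), ex_trig_series; intros; apply Rabs_sin.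
  - intros k; rewrite wshift_eq; ring.
Qed.

Let wshift_bound : exists B, 0 < B /\ forall k x, Rabs (wshift k x) <= B.
Proof.
  destruct (qb_lt_1_bound q g Hq Hg) as [M [r [HM [Hr H]]]].
  exists (M * / (1 - r)); split; [apply Rmult_lt_0_compat; [|apply Rinv_0_lt_compat]; lra|].
  intros k x; unfold wshift.
  assert (Hr' : Rabs r < 1) by (rewrite Rabs_pos_eq; lra).
  assert (HB : forall l, Rabs (a l * cos (IZR (2 * (Z.of_nat k - Z.of_nat l)) * x)) <= M * r ^ l).
  { intros l; rewrite Rabs_mult, <- (Rmult_1_r (M * r ^ l)).
    apply Rmult_le_compat; auto using Rabs_pos, Rabs_cos. }
  rewrite <- Series_geom, <- Series_scal_l by exact Hr'.
  eapply Rle_trans; [apply Series_Rabs|].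
  - apply (ex_series_le (K := R_AbsRing) (V := R_CompleteNormedModule)) with (fun k => M * r ^ k);
      [|apply ex_series_scal_geom, Hr'].
    intros l; change (norm ?y) with (Rabs y); rewrite Rabs_Rabsolu; apply HB.
  - apply Series_le; [|apply ex_series_scal_geom, Hr'].
    intros l; split; [apply Rabs_pos | apply HB].
Qed.

Let continuous_wshift (k : nat) (x : R) : continuous (wshift k) x.
Proof. apply continuous_trig_series; [intros; apply Rabs_cos | intros; apply continuous_cos_mult]. Qed.

Definition wcos (j : nat) : R := RInt (fun x => cos (INR j * x) * wt q g x) 0 PI.

Let PI_pos : 0 <= PI.
Proof. left; apply PI_RGT_0. Qed.

Let inner (j k : nat) : R := RInt (fun x => cos (INR j * x) * wshift k x) 0 PI.

Let is_series_wcos (j : nat) : is_series (fun k => a k * inner j k) (wcos j).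
Proof.
  unfold inner.
  destruct wshift_bound as [B [HB Hw]].
  destruct (qb_lt_1_bound q g Hq Hg) as [M [r [HM [Hr H]]]].
  assert (Hc : forall k x, continuous (fun x => cos (INR j * x) * wshift k x) x).
  { intros; apply continuous_Rmult; [apply continuous_cos_mult | apply continuous_wshift]. }
  apply is_series_ext with (fun k => RInt (fun x => a k * (cos (INR j * x) * wshift k x)) 0 PI);
    [intros k; apply RInt_Rscal, Hc|].
  unfold wcos.
  rewrite (RInt_ext _ (fun x => Series (fun k => a k * (cos (INR j * x) * wshift k x)))).
  - apply is_series_RInt with (fun k => M * B * r ^ k); [exact PI_pos | | |].
    + intros k x; apply continuous_Rmult; [apply continuous_const | apply Hc].
    + intros k x; rewrite !Rabs_mult.
      replace (M * B * r ^ k) with (M * r ^ k * (1 * B)) by ring.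
      repeat apply Rmult_le_compat; auto using Rabs_pos, Rabs_cos.
      apply Rmult_le_pos; apply Rabs_pos.
    + apply ex_series_scal_geom; rewrite Rabs_pos_eq; lra.
  - intros x _; rewrite wt_series, <- Series_scal_l; apply Series_ext; intros; ring.
Qed.

Let is_series_inner (j k : nat) :
  is_series (fun l => a l * (/ 2 * ((if Z.eqb (Z.of_nat j + 2 * (Z.of_nat k - Z.of_nat l)) 0 then PI else 0)
     + (if Z.eqb (Z.of_nat j - 2 * (Z.of_nat k - Z.of_nat l)) 0 then PI else 0))))
    (inner j k).
Proof.
  unfold inner.
  assert (Hc : forall l x, continuous (fun x => cos (IZR (Z.of_nat j) * x) * cos (IZR (2 * (Z.of_nat k - Z.of_nat l)) * x)) x).
  { intros; apply continuous_Rmult; apply continuous_cos_mult. }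
  set (f := fun l x => cos (IZR (Z.of_nat j) * x) * cos (IZR (2 * (Z.of_nat k - Z.of_nat l)) * x)).
  apply is_series_ext with (fun l => RInt (fun x => a l * f l x) 0 PI).
  { intros l; rewrite <- RInt_cos_cos; apply RInt_Rscal, Hc. }
  destruct (trig_series_bound f) as [M [HM H]].
  { intros l x; unfold f; rewrite Rabs_mult, <- (Rmult_1_r 1).
    apply Rmult_le_compat; auto using Rabs_pos, Rabs_cos. }
  rewrite (RInt_ext _ (fun x => Series (fun l => a l * f l x))).
  - apply is_series_RInt with M; [exact PI_pos | | exact H | exact HM].
    intros l x; apply continuous_Rmult; [apply continuous_const | apply Hc].
  - intros x _; unfold wshift, f; rewrite <- Series_scal_l; apply Series_ext; intros l.
    rewrite INR_IZR_INZ; ring.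
Qed.

Lemma wcos_odd (p : nat) : wcos (2 * p + 1) = 0.
Proof.
  assert (H := is_series_wcos (2 * p + 1)).
  assert (H0 := is_series_unique _ _ is_series_0).
  apply is_series_unique in H; rewrite <- H; clear H.
  etransitivity; [|exact H0]; apply Series_ext; intros k.
  assert (H := is_series_inner (2 * p + 1) k).
  apply is_series_unique in H; rewrite <- H.
  etransitivity; [|apply (Rmult_0_r (a k))]; f_equal.
  etransitivity; [|exact H0]; apply Series_ext; intros l.
  rewrite (proj2 (Z.eqb_neq _ _)) by lia; rewrite (proj2 (Z.eqb_neq _ _)) by lia; ring.
Qed.

Lemma wcos_even (m : nat) : wcos (2 * m) = PI * omega q g m.
Proof.
  assert (H := is_series_wcos (2 * m)).
  set (c := fun k => / 2 * PI * (a k * a (k + m)%nat) + / 2 * PI * (if (m <=? k)%nat then a k * a (k - m)%nat else 0)).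
  assert (Hc : is_series c (PI * omega q g m)).
  { replace (PI * omega q g m) with (/ 2 * PI * omega q g m + / 2 * PI * omega q g m) by field.
    apply is_series_Rplus; apply is_series_Rscal; [apply is_series_omega; assumption|].
    apply is_series_drop with m.
    - intros k Hk; rewrite (proj2 (Nat.leb_gt m k)) by lia; reflexivity.
    - apply is_series_ext with (fun k => a k * a (k + m)%nat); [|apply is_series_omega; assumption].
      intros k; rewrite (proj2 (Nat.leb_le m (m + k))) by lia.
      replace (m + k - m)%nat with k by lia; rewrite (Nat.add_comm m k); as_R; ring. }
  apply is_series_unique in H; apply is_series_unique in Hc.
  rewrite <- H, <- Hc; apply Series_ext; intros k; unfold c.
  assert (Hi := is_series_inner (2 * m) k).
  assert (Hi' : is_series (fun l => a l * (/ 2 * (if (l =? k + m)%nat then PI else 0))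
     + a l * (/ 2 * (if (l + m =? k)%nat then PI else 0)))
     (/ 2 * PI * a (k + m)%nat + / 2 * PI * (if (m <=? k)%nat then a (k - m)%nat else 0))).
  { apply is_series_Rplus.
    - evar_last; [apply (is_series_single _ (k + m)%nat)|].
      + intros l Hl; rewrite (proj2 (Nat.eqb_neq l (k + m))) by exact Hl; ring.
      + cbv beta; rewrite Nat.eqb_refl; as_R; ring.
    - destruct (Nat.leb_spec m k) as [Hle|Hlt].
      + evar_last; [apply (is_series_single _ (k - m)%nat)|].
        * intros l Hl; rewrite (proj2 (Nat.eqb_neq (l + m) k)) by lia; ring.
        * cbv beta; rewrite (proj2 (Nat.eqb_eq (k - m + m) k)) by lia; as_R; ring.
      + rewrite Rmult_0_r; apply is_series_ext with (fun _ => 0); [|apply is_series_0].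
        intros l; rewrite (proj2 (Nat.eqb_neq (l + m) k)) by lia; as_R; ring. }
  apply is_series_unique in Hi; apply is_series_unique in Hi'.
  rewrite <- Hi.
  transitivity (a k * (/ 2 * PI * a (k + m)%nat + / 2 * PI * (if (m <=? k)%nat then a (k - m)%nat else 0)));
    [|destruct (m <=? k)%nat; ring].
  rewrite <- Hi'; f_equal; apply Series_ext; intros l.
  replace (Z.eqb (Z.of_nat (2 * m) + 2 * (Z.of_nat k - Z.of_nat l)) 0) with (l =? k + m)%nat.
  - replace (Z.eqb (Z.of_nat (2 * m) - 2 * (Z.of_nat k - Z.of_nat l)) 0) with (l + m =? k)%nat; [ring|].
    destruct (Nat.eqb_spec (l + m) k); symmetry; [apply Z.eqb_eq | apply Z.eqb_neq]; lia.
  - destruct (Nat.eqb_spec l (k + m)); symmetry; [apply Z.eqb_eq | apply Z.eqb_neq]; lia.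
Qed.

End Weight.

(** * Infinite products *)

Ltac as_C := match goal with |- ?x = ?y => change (@eq C x y); cbv beta end.

Definition Clim (u : nat -> C) (l : C) : Prop := is_lim_seq (fun n => Cmod (u n - l)%C) 0.

Lemma im_le_Cmod (c : C) : Rabs (Im c) <= Cmod c.
Proof. eapply Rle_trans; [apply Rmax_r | apply Rmax_Cmod]. Qed.

Lemma Cmod_le_re_im (c : C) : Cmod c <= Rabs (Re c) + Rabs (Im c).
Proof.
  destruct c as [x y].
  assert (E : (x, y) = (RtoC x + RtoC y * Ci)%C).
  { unfold RtoC, Ci, Cplus, Cmult; simpl; f_equal; ring. }
  rewrite E at 1; eapply Rle_trans; [apply Cmod_triangle|].
  rewrite Cmod_mult, Cmod_Ci, !Cmod_R, Rmult_1_r; apply Rle_refl.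
Qed.

Lemma is_lim_seq_squeeze_0 (u v : nat -> R) :
  (forall n, 0 <= u n <= v n) -> is_lim_seq v 0 -> is_lim_seq u 0.
Proof. intros H Hv; apply is_lim_seq_le_le with (fun _ => 0) v; auto using is_lim_seq_const. Qed.

Lemma is_lim_seq_of_diff (u : nat -> R) (l : R) :
  is_lim_seq (fun n => Rabs (u n - l)) 0 -> is_lim_seq u l.
Proof.
  intros H; apply is_lim_seq_abs_0 in H.
  apply is_lim_seq_ext with (fun n => (u n - l) + l); [intros; ring|].
  replace (Finite l) with (Finite (0 + l)) by (f_equal; ring).
  apply is_lim_seq_plus'; [exact H | apply is_lim_seq_const].
Qed.

Lemma Clim_Re (u : nat -> C) (l : C) : Clim u l -> is_lim_seq (fun n => Re (u n)) (Re l).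
Proof.
  intros H; apply is_lim_seq_of_diff; revert H; apply is_lim_seq_squeeze_0.
  intros n; split; [apply Rabs_pos|]; apply (re_le_Cmod (u n - l)).
Qed.

Lemma Clim_Im (u : nat -> C) (l : C) : Clim u l -> is_lim_seq (fun n => Im (u n)) (Im l).
Proof.
  intros H; apply is_lim_seq_of_diff; revert H; apply is_lim_seq_squeeze_0.
  intros n; split; [apply Rabs_pos|]; apply (im_le_Cmod (u n - l)).
Qed.

Lemma Clim_of_parts (u : nat -> C) (a b : R) :
  is_lim_seq (fun n => Re (u n)) a -> is_lim_seq (fun n => Im (u n)) b -> Clim u (a, b).
Proof.
  intros Ha Hb.
  apply is_lim_seq_squeeze_0 with (fun n => Rabs (Re (u n) - a) + Rabs (Im (u n) - b)).
  - intros n; split; [apply Cmod_ge_0|]; apply (Cmod_le_re_im (u n - (a, b))).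
  - replace (Finite 0) with (Finite (0 + 0)) by (f_equal; ring).
    apply is_lim_seq_plus'.
    + apply -> (is_lim_seq_abs_0 (fun n => Re (u n) - a)); replace (Finite 0) with (Finite (a - a)) by (f_equal; ring).
      apply is_lim_seq_minus'; [exact Ha | apply is_lim_seq_const].
    + apply -> (is_lim_seq_abs_0 (fun n => Im (u n) - b)); replace (Finite 0) with (Finite (b - b)) by (f_equal; ring).
      apply is_lim_seq_minus'; [exact Hb | apply is_lim_seq_const].
Qed.

Lemma CLim_seq_Clim (u : nat -> C) (l : C) : Clim u l -> CLim_seq u = l.
Proof.
  intros H; unfold CLim_seq.
  rewrite (is_lim_seq_unique _ _ (Clim_Re _ _ H)), (is_lim_seq_unique _ _ (Clim_Im _ _ H)).
  destruct l; reflexivity.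
Qed.

Lemma Clim_unique (u : nat -> C) (l m : C) : Clim u l -> Clim u m -> l = m.
Proof. intros H1 H2; rewrite <- (CLim_seq_Clim _ _ H1); apply CLim_seq_Clim, H2. Qed.

Lemma Clim_ext (u v : nat -> C) (l : C) : (forall n, u n = v n) -> Clim u l -> Clim v l.
Proof. intros H; apply is_lim_seq_ext; intros n; rewrite H; reflexivity. Qed.

Lemma Clim_const (l : C) : Clim (fun _ => l) l.
Proof.
  apply is_lim_seq_ext with (fun _ => 0); [|apply is_lim_seq_const].
  intros _; unfold Cminus; rewrite Cplus_opp_r, Cmod_0; reflexivity.
Qed.

Lemma Clim_plus (u v : nat -> C) (l m : C) :
  Clim u l -> Clim v m -> Clim (fun n => u n + v n)%C (l + m)%C.
Proof.
  intros Hu Hv; apply is_lim_seq_squeeze_0 with (fun n => Cmod (u n - l)%C + Cmod (v n - m)%C).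
  - intros n; split; [apply Cmod_ge_0|].
    replace (u n + v n - (l + m))%C with ((u n - l) + (v n - m))%C by ring; apply Cmod_triangle.
  - replace (Finite 0) with (Finite (0 + 0)) by (f_equal; ring); apply is_lim_seq_plus'; assumption.
Qed.

Lemma Clim_mult (u v : nat -> C) (l m : C) :
  Clim u l -> Clim v m -> Clim (fun n => u n * v n)%C (l * m)%C.
Proof.
  intros Hu Hv.
  apply is_lim_seq_squeeze_0 with (fun n => Cmod (u n - l)%C * Cmod (v n - m)%C
    + (Cmod (u n - l)%C * Cmod m + Cmod l * Cmod (v n - m)%C)).
  - intros n; split; [apply Cmod_ge_0|].
    replace (u n * v n - l * m)%C with ((u n - l) * (v n - m) + ((u n - l) * m + l * (v n - m)))%C by ring.
    rewrite <- !Cmod_mult; eapply Rle_trans; [apply Cmod_triangle|].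
    apply Rplus_le_compat_l, Cmod_triangle.
  - replace (Finite 0) with (Finite (0 * 0 + (0 * Cmod m + Cmod l * 0))) by (f_equal; ring).
    apply is_lim_seq_plus'; [apply is_lim_seq_mult'; assumption|].
    apply is_lim_seq_plus'; apply is_lim_seq_mult'; auto using is_lim_seq_const.
Qed.

Lemma Clim_minus (u v : nat -> C) (l m : C) :
  Clim u l -> Clim v m -> Clim (fun n => u n - v n)%C (l - m)%C.
Proof.
  intros Hu Hv; replace (l - m)%C with (l + RtoC (-1) * m)%C by ring.
  apply Clim_ext with (fun n => u n + RtoC (-1) * v n)%C; [intros; ring|].
  apply Clim_plus, Clim_mult; auto using Clim_const.
Qed.

Lemma Clim_0_of_bound (u : nat -> C) (v : nat -> R) :
  (forall n, Cmod (u n) <= v n) -> is_lim_seq v 0 -> Clim u 0.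
Proof.
  intros H; apply is_lim_seq_squeeze_0; intros n; split; [apply Cmod_ge_0|].
  replace (u n - 0)%C with (u n) by ring; apply H.
Qed.

Lemma Clim_subseq (u : nat -> C) (l : C) (phi : nat -> nat) :
  (forall n, (phi n < phi (S n))%nat) -> Clim u l -> Clim (fun n => u (phi n)) l.
Proof.
  intros Hphi H; exact (is_lim_seq_subseq (fun n => Cmod (u n - l)%C) 0 phi (eventually_subseq phi Hphi) H).
Qed.

Lemma Clim_Cmod_le (u : nat -> C) (l c : C) (K : R) :
  (forall n, Cmod (u n - c)%C <= K) -> Clim u l -> Cmod (l - c)%C <= K.
Proof.
  intros HK H.
  assert (Hl : is_lim_seq (fun n => Cmod (u n - l)%C + K) (0 + K)).
  { apply is_lim_seq_plus'; [exact H | apply is_lim_seq_const]. }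
  rewrite Rplus_0_l in Hl.
  refine (is_lim_seq_le (fun _ => Cmod (l - c)%C) _ (Finite _) (Finite _) _ (is_lim_seq_const _) Hl).
  intros n; replace (l - c)%C with (- (u n - l) + (u n - c))%C by ring.
  eapply Rle_trans; [apply Cmod_triangle|]; rewrite Cmod_opp; specialize (HK n); lra.
Qed.

Lemma Csum_S (u : nat -> C) (n : nat) : sum_n u (S n) = (sum_n u n + u (S n))%C.
Proof. exact (@sum_Sn C_AbelianMonoid u n). Qed.

Lemma Csum_0 (u : nat -> C) : sum_n u 0 = u 0%nat.
Proof. exact (@sum_O C_AbelianMonoid u). Qed.

Lemma Re_sum_n (u : nat -> C) (n : nat) : Re (sum_n u n) = sum_n (fun k => Re (u k)) n.
Proof.
  induction n as [|n IH]; [rewrite Csum_0, sum_O; reflexivity|].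
  rewrite Csum_S, sum_Sn, <- IH; reflexivity.
Qed.

Lemma Im_sum_n (u : nat -> C) (n : nat) : Im (sum_n u n) = sum_n (fun k => Im (u k)) n.
Proof.
  induction n as [|n IH]; [rewrite Csum_0, sum_O; reflexivity|].
  rewrite Csum_S, sum_Sn, <- IH; reflexivity.
Qed.

Lemma Clim_sum_of_bound (u : nat -> C) (B : nat -> R) :
  (forall k, Cmod (u k) <= B k) -> ex_series B ->
  Clim (sum_n u) (Series (fun k => Re (u k)), Series (fun k => Im (u k))).
Proof.
  intros Hu HB; apply Clim_of_parts.
  - apply is_lim_seq_ext with (sum_n (fun k => Re (u k))); [intros; symmetry; apply Re_sum_n|].
    apply (Series_correct (fun k => Re (u k))).
    apply (ex_series_le (K := R_AbsRing) (V := R_CompleteNormedModule)) with B; [|exact HB].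
    intros k; eapply Rle_trans; [apply re_le_Cmod | apply Hu].
  - apply is_lim_seq_ext with (sum_n (fun k => Im (u k))); [intros; symmetry; apply Im_sum_n|].
    apply (Series_correct (fun k => Im (u k))).
    apply (ex_series_le (K := R_AbsRing) (V := R_CompleteNormedModule)) with B; [|exact HB].
    intros k; eapply Rle_trans; [apply im_le_Cmod | apply Hu].
Qed.

Lemma Csum_diff (u : nat -> C) (n : nat) :
  (u 0%nat + sum_n (fun k => u (S k) - u k)%C n)%C = u (S n).
Proof.
  induction n as [|n IH]; [rewrite Csum_0; ring|].
  rewrite Csum_S, Cplus_assoc, IH; ring.
Qed.

Lemma Clim_incr (u : nat -> C) (l : C) : Clim (fun n => u (S n)) l -> Clim u l.
Proof. intros H; apply is_lim_seq_incr_1; exact H. Qed.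

Lemma ex_Clim (u : nat -> C) (B : nat -> R) :
  (forall k, Cmod (u (S k) - u k)%C <= B k) -> ex_series B -> exists l, Clim u l.
Proof.
  intros Hu HB; eexists; apply Clim_incr.
  eapply Clim_ext; [intros n; apply Csum_diff|].
  apply Clim_plus; [apply Clim_const | apply (Clim_sum_of_bound _ B Hu HB)].
Qed.

Lemma Cmod_one_minus_le (a : C) : Cmod (1 - a)%C <= 1 + Cmod a.
Proof.
  replace (1 - a)%C with (1 + - a)%C by ring.
  eapply Rle_trans; [apply Cmod_triangle|]; rewrite Cmod_opp, Cmod_1; lra.
Qed.

Lemma Cmod_one_minus_ge (a : C) : 1 - Cmod a <= Cmod (1 - a)%C.
Proof.
  assert (H := Cmod_triangle (1 - a)%C a); replace (1 - a + a)%C with (RtoC 1) in H by ring.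
  rewrite Cmod_1 in H; lra.
Qed.

Section Pochhammer.
Context (q : R) (Hq : Rabs q < 1).

Let Hq1 : 0 <= Rabs q < 1.
Proof. split; [apply Rabs_pos | exact Hq]. Qed.

Let Cmod_aq (a : C) (n : nat) : Cmod (a * q ^ n)%C = Cmod a * Rabs q ^ n.
Proof. rewrite Cmod_mult, Cmod_pow, Cmod_R; reflexivity. Qed.

Lemma Clim_qpoch (a : C) : Clim (qpoch a q) (qpoch_inf a q).
Proof.
  assert (Hb : forall n, Cmod (qpoch a q n) <= exp (Cmod a / (1 - Rabs q))).
  { apply prod_exp_bound; auto using Cmod_ge_0.
    - apply Cmod_1.
    - intros n; cbn [qpoch]; rewrite Cmod_mult; apply Rmult_le_compat_l; [apply Cmod_ge_0|].
      eapply Rle_trans; [apply Cmod_one_minus_le|]; rewrite Cmod_aq; apply exp_ineq1_le. }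
  destruct (ex_Clim (qpoch a q) (fun n => exp (Cmod a / (1 - Rabs q)) * Cmod a * Rabs q ^ n)) as [l Hl].
  - intros n; cbn [qpoch].
    replace (qpoch a q n * (1 - a * q ^ n) - qpoch a q n)%C with (- (qpoch a q n * (a * q ^ n)))%C by ring.
    rewrite Cmod_opp, Cmod_mult, Cmod_aq, Rmult_assoc; apply Rmult_le_compat_r; [|apply Hb].
    apply Rmult_le_pos; [apply Cmod_ge_0 | apply pow_le, Rabs_pos].
  - apply ex_series_scal_geom; rewrite Rabs_Rabsolu; exact Hq.
  - unfold qpoch_inf; rewrite (CLim_seq_Clim _ _ Hl); exact Hl.
Qed.

Let Cmod_aq_lt_1 (a : C) (n : nat) : Cmod a < 1 -> Cmod a * Rabs q ^ n <= Cmod a.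
Proof.
  intros Ha; assert (H := Cmod_ge_0 a); assert (H1 := Rabs_pow_le_1 q n Hq).
  rewrite <- RPow_abs in H1; nra.
Qed.

Lemma qpoch_neq_0 (a : C) (n : nat) : Cmod a < 1 -> qpoch a q n <> RtoC 0.
Proof.
  intros Ha; induction n as [|n IH]; cbn [qpoch]; [apply C1_nz|].
  apply Cmult_neq_0; [exact IH|]; apply Cmod_gt_0.
  assert (H := Cmod_one_minus_ge (a * q ^ n)); rewrite Cmod_aq in H.
  assert (H1 := Cmod_aq_lt_1 a n Ha); lra.
Qed.

Lemma qpoch_inf_neq_0 (a : C) : Cmod a < 1 -> qpoch_inf a q <> RtoC 0.
Proof.
  intros Ha.
  assert (Hn : forall n, 0 < Cmod (qpoch a q n)) by (intros n; apply Cmod_gt_0, qpoch_neq_0, Ha).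
  set (K := exp ((Cmod a / (1 - Cmod a)) / (1 - Rabs q))).
  assert (HK : 0 < K) by apply exp_pos.
  assert (Hb : forall n, / Cmod (qpoch a q n) <= K).
  { apply prod_exp_bound; auto.
    - apply Rmult_le_pos; [apply Cmod_ge_0 | left; apply Rinv_0_lt_compat; lra].
    - cbn [qpoch]; rewrite Cmod_1; apply Rinv_1.
    - intros n; left; apply Rinv_0_lt_compat, Hn.
    - intros n; assert (HSn := Hn (S n)); cbn [qpoch] in HSn |- *; rewrite Cmod_mult in HSn |- *.
      rewrite Rinv_mult; apply Rmult_le_compat_l; [left; apply Rinv_0_lt_compat, Hn|].
      assert (H := Cmod_one_minus_ge (a * q ^ n)); rewrite Cmod_aq in H.
      assert (H1 := Cmod_aq_lt_1 a n Ha).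
      apply Rle_trans with (/ (1 - Cmod a * Rabs q ^ n)); [apply Rinv_le_contravar; lra|].
      eapply Rle_trans; [apply (inv_one_minus_le _ (Cmod a)); [split; [|exact H1] | exact Ha]|].
      + apply Rmult_le_pos; [apply Cmod_ge_0 | apply pow_le, Rabs_pos].
      + right; f_equal; unfold Rdiv; ring. }
  intros H0; assert (Hl := Clim_qpoch a); rewrite H0 in Hl.
  assert (Hge : Rbar_le (/ K) 0).
  { apply is_lim_seq_le with (fun _ => / K) (fun n => Cmod (qpoch a q n - RtoC 0)%C); [|apply is_lim_seq_const | exact Hl].
    intros n; replace (qpoch a q n - RtoC 0)%C with (qpoch a q n) by ring.
    rewrite <- (Rinv_inv (Cmod _)); apply Rinv_le_contravar; [apply Rinv_0_lt_compat, Hn | apply Hb]. }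
  simpl in Hge; assert (0 < / K) by (apply Rinv_0_lt_compat, HK); lra.
Qed.

Lemma qpoch_RtoC (a : R) (n : nat) : qpoch a q n = RtoC (rpoch a q n).
Proof.
  induction n as [|n IH]; [reflexivity|]; cbn [qpoch rpoch].
  rewrite IH, RtoC_mult, RtoC_minus, RtoC_mult, RtoC_pow; reflexivity.
Qed.

Lemma qpoch_split (a : C) (n k : nat) : qpoch a q (n + k) = (qpoch a q n * qpoch (a * q ^ n) q k)%C.
Proof.
  induction k as [|k IH]; [rewrite Nat.add_0_r; cbn [qpoch]; ring|].
  rewrite Nat.add_succ_r; cbn [qpoch]; rewrite IH, Cpow_add_r; ring.
Qed.

Definition cps (s : nat -> C) (z : C) : C :=
  (Series (fun k => Re (s k * z ^ k)%C), Series (fun k => Im (s k * z ^ k)%C)).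

Section PowerSeries.
Context (s : nat -> C) (B : nat -> R) (z : C).
Context (HB : ex_series B) (Hs : forall k, Cmod (s k * z ^ k)%C <= B k).

Let Hscale (N k : nat) : Cmod (s k * (q ^ N * z) ^ k)%C <= B k.
Proof.
  rewrite Cpow_mult_l; replace (s k * ((q ^ N) ^ k * z ^ k))%C with ((q ^ N) ^ k * (s k * z ^ k))%C by ring.
  rewrite Cmod_mult, !Cmod_pow, Cmod_R, <- (Rmult_1_l (B k)).
  apply Rmult_le_compat; auto using Cmod_ge_0.
  - apply pow_le, pow_le, Rabs_pos.
  - rewrite <- pow_mult, RPow_abs; apply Rabs_pow_le_1, Hq.
Qed.

Lemma Clim_cps_scaled (N : nat) :
  Clim (sum_n (fun k => s k * (q ^ N * z) ^ k)%C) (cps s (q ^ N * z)%C).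
Proof. apply Clim_sum_of_bound with B; auto. Qed.

Lemma cps_scaled_lim : Clim (fun N => cps s (q ^ N * z)%C) (s 0%nat).
Proof.
  assert (HB0 : forall k, 0 <= B k) by (intros k; eapply Rle_trans; [apply Cmod_ge_0 | apply Hs]).
  assert (Hsum : forall n, sum_n B n <= Series B).
  { intros n; rewrite <- (Rplus_0_r (sum_n B n)), (Series_incr_n B (S n)), <- sum_n_Reals by (auto; lia).
    apply Rplus_le_compat_l.
    rewrite <- (Rmult_0_l (Series (fun _ => 0))), <- Series_scal_l.
    apply Series_le; [intros k; split; [lra | rewrite Rmult_0_l; apply HB0]|].
    apply -> (ex_series_incr_n B (S n)); exact HB. }
  apply is_lim_seq_squeeze_0 with (fun N => Series B * Rabs q ^ N).
  - intros N; split; [apply Cmod_ge_0|].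
    apply Clim_Cmod_le with (2 := Clim_cps_scaled N).
    assert (HqN : 0 <= Rabs q ^ N <= 1).
    { split; [apply pow_le, Rabs_pos | rewrite RPow_abs; apply Rabs_pow_le_1, Hq]. }
    intros n; apply Rle_trans with (sum_n B n * Rabs q ^ N); [|apply Rmult_le_compat_r; [apply HqN | apply Hsum]].
    induction n as [|n IH].
    + rewrite Csum_0, sum_O; replace (_ - _)%C with (RtoC 0) by (cbn [Cpow]; ring).
      rewrite Cmod_0; apply Rmult_le_pos; [apply HB0 | apply HqN].
    + rewrite Csum_S, sum_Sn; change plus with Rplus.
      match goal with |- Cmod (?x + ?y - ?w)%C <= _ => replace (x + y - w)%C with ((x - w) + y)%C by ring end.
      eapply Rle_trans; [apply Cmod_triangle|].
      rewrite Rmult_plus_distr_r; apply Rplus_le_compat; [exact IH|].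
      rewrite Cpow_mult_l; replace (s (S n) * ((q ^ N) ^ S n * z ^ S n))%C
        with ((s (S n) * z ^ S n) * (q ^ N) ^ S n)%C by ring.
      rewrite Cmod_mult, !Cmod_pow, Cmod_R; apply Rmult_le_compat; auto using Cmod_ge_0.
      * apply pow_le, pow_le, Rabs_pos.
      * cbn [pow]; assert (H : (Rabs q ^ N) ^ n <= 1) by (rewrite <- (pow1 n); apply pow_incr; lra).
        assert (H0 : 0 <= (Rabs q ^ N) ^ n) by (apply pow_le; lra); nra.
  - replace (Finite 0) with (Rbar_mult (Series B) 0) by (simpl; f_equal; ring).
    apply is_lim_seq_scal_l, is_lim_seq_geom; rewrite Rabs_Rabsolu; exact Hq.
Qed.

(* Iterating [f (w) S (w) = g (w) S (q w)] and letting [q^N w -> 0] expresses [S (z) / S (0)] as the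
   infinite product of the ratios [g (q^N z) / f (q^N z)]. *)
Lemma cps_product (f g : C -> C) (F G : nat -> C) (Finf Ginf : C) :
  (forall N, (f (q ^ N * z) * cps s (q ^ N * z) = g (q ^ N * z) * cps s (q ^ S N * z))%C) ->
  F 0%nat = RtoC 1 -> G 0%nat = RtoC 1 ->
  (forall N, F (S N) = (F N * f (q ^ N * z))%C) -> (forall N, G (S N) = (G N * g (q ^ N * z))%C) ->
  Clim F Finf -> Clim G Ginf ->
  (cps s z * Finf = Ginf * s 0%nat)%C.
Proof.
  intros Hfg HF0 HG0 HFS HGS HF HG.
  assert (H : forall N, (cps s z * F N = G N * cps s (q ^ N * z))%C).
  { intros N; induction N as [|N IH].
    - rewrite HF0, HG0; cbn [Cpow]; rewrite !Cmult_1_l; ring.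
    - rewrite HFS, HGS, Cmult_assoc, IH.
      transitivity (G N * (f (q ^ N * z) * cps s (q ^ N * z)))%C; [ring|]; rewrite Hfg; ring. }
  apply Clim_unique with (fun N => cps s z * F N)%C.
  - apply Clim_mult; [apply Clim_const | exact HF].
  - eapply Clim_ext; [intros N; symmetry; apply H|].
    apply Clim_mult; [exact HG | apply cps_scaled_lim].
Qed.

End PowerSeries.

Lemma qbinomial (x b : R) (B : nat -> R) (z : C) :
  ex_series B -> (forall k, Rabs (qb q x b k) <= B k) -> Cmod z <= 1 ->
  (cps (fun k => RtoC (qb q x b k)) z * qpoch_inf (x * z) q = qpoch_inf (b * z) q)%C.
Proof.
  intros HB Hb Hz.
  assert (Hs : forall w k, Cmod w <= 1 -> Cmod (RtoC (qb q x b k) * w ^ k)%C <= B k).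
  { intros w k Hw; rewrite Cmod_mult, Cmod_R, Cmod_pow, <- (Rmult_1_r (B k)).
    apply Rmult_le_compat; auto using Rabs_pos.
    - apply pow_le, Cmod_ge_0.
    - rewrite <- (pow1 k); apply pow_incr; split; [apply Cmod_ge_0 | exact Hw]. }
  rewrite <- (Cmult_1_r (qpoch_inf (b * z) q)).
  assert (Hsc : forall N, Cmod (q ^ N * z)%C <= 1).
  { intros N; rewrite Cmod_mult, Cmod_pow, Cmod_R, RPow_abs.
    assert (H := Rabs_pow_le_1 q N Hq); assert (H1 := Cmod_ge_0 z); assert (H2 := Rabs_pos (q ^ N)); nra. }
  apply (cps_product _ B z HB (fun k => Hs z k Hz) (fun w => 1 - x * w)%C (fun w => 1 - b * w)%C
    (qpoch (x * z) q) (qpoch (b * z) q)); try reflexivity.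
  - intros N; set (w := (q ^ N * z)%C).
    assert (Hw : Cmod w <= 1) by apply Hsc.
    replace (q ^ S N * z)%C with (q ^ 1 * w)%C by (unfold w; rewrite Cpow_1_r, Cpow_S; ring).
    set (a := fun k => RtoC (qb q x b k)).
    assert (Hfin : forall n, ((1 - x * w) * sum_n (fun k => a k * w ^ k) n
        - (1 - b * w) * sum_n (fun k => a k * (q ^ 1 * w) ^ k) n
        = - (w * (x - b * q ^ n) * (a n * w ^ n)))%C).
    { intros n; induction n as [|n IH].
      - rewrite !Csum_0; unfold a; cbn [qb Cpow]; ring.
      - rewrite !Csum_S, !Cmult_plus_distr_l.
        match goal with |- (?x1 + ?y1 - (?x2 + ?y2))%C = _ =>
          transitivity ((x1 - x2) + (y1 - y2))%C; [ring|] end.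
        rewrite IH; assert (Ha : (a (S n) * (1 - q ^ S n) = a n * (x - b * q ^ n))%C).
        { unfold a; rewrite <- RtoC_pow, <- RtoC_minus, <- RtoC_mult, qb_S by exact Hq.
          rewrite RtoC_mult, RtoC_minus, RtoC_mult, RtoC_pow; reflexivity. }
        transitivity (- (w * w ^ n * (a n * (x - b * q ^ n)))
          + ((1 - x * w) * (a (S n) * w ^ S n) - (1 - b * w) * (a (S n) * (q ^ 1 * w) ^ S n)))%C; [ring|].
        rewrite <- Ha, Cpow_1_r, Cpow_mult_l, !Cpow_S; ring. }
    assert (H0 : Clim (fun n => (1 - x * w) * sum_n (fun k => a k * w ^ k) n
        - (1 - b * w) * sum_n (fun k => a k * (q ^ 1 * w) ^ k) n)%C
        ((1 - x * w) * cps a w - (1 - b * w) * cps a (q ^ 1 * w))%C).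
    { apply Clim_minus; apply Clim_mult; try apply Clim_const.
      - apply Clim_sum_of_bound with B; [intros k; apply Hs, Hw | exact HB].
      - apply (Clim_cps_scaled a B w HB (fun k => Hs w k Hw) 1). }
    assert (H1 : Clim (fun n => (1 - x * w) * sum_n (fun k => a k * w ^ k) n
        - (1 - b * w) * sum_n (fun k => a k * (q ^ 1 * w) ^ k) n)%C 0).
    { eapply Clim_ext; [intros n; symmetry; apply Hfin|].
      apply Clim_0_of_bound with (fun n => (Rabs x + Rabs b) * B n).
      - intros n; rewrite Cmod_opp, !Cmod_mult.
        apply Rmult_le_compat; auto using Cmod_ge_0.
        + apply Rmult_le_pos; apply Cmod_ge_0.
        + apply Rmult_le_pos; [apply Cmod_ge_0 | rewrite Cmod_pow; apply pow_le, Cmod_ge_0].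
        + apply Rle_trans with (1 * Cmod (x - b * q ^ n)%C); [apply Rmult_le_compat_r; auto using Cmod_ge_0|].
          rewrite Rmult_1_l; replace (x - b * q ^ n)%C with (x + - (b * q ^ n))%C by ring.
          eapply Rle_trans; [apply Cmod_triangle|].
          rewrite Cmod_opp, Cmod_mult, Cmod_pow, !Cmod_R; apply Rplus_le_compat_l.
          rewrite <- (Rmult_1_r (Rabs b)) at 2; apply Rmult_le_compat_l; [apply Rabs_pos|].
          rewrite RPow_abs; apply Rabs_pow_le_1, Hq.
        + rewrite <- Cmod_mult; apply Hs, Hw.
      - replace (Finite 0) with (Rbar_mult (Rabs x + Rabs b) 0) by (simpl; f_equal; ring).
        apply is_lim_seq_scal_l, ex_series_lim_0, HB. }
    assert (H2 := Clim_unique _ _ _ H0 H1).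
    replace ((1 - x * w) * cps a w)%C
      with ((1 - x * w) * cps a w - (1 - b * w) * cps a (q ^ 1 * w) + (1 - b * w) * cps a (q ^ 1 * w))%C by ring.
    rewrite H2; ring.
  - intros N; cbn [qpoch]; ring.
  - intros N; cbn [qpoch]; ring.
  - apply Clim_qpoch.
  - apply Clim_qpoch.
Qed.

End Pochhammer.

(** * Rogers polynomials *)

Fixpoint rp_pair (b q x : R) (n : nat) : R * R :=
  match n with
  | O => (1, 2 * x * (1 - b) / (1 - q))
  | S m => let (u, v) := rp_pair b q x m in
      (v, (2 * x * (1 - b * q ^ S m) * v - (1 - b ^ 2 * q ^ m) * u) / (1 - q ^ S (S m)))
  end.

Definition rp (b q x : R) (n : nat) : R := fst (rp_pair b q x n).

Lemma rp_pair_snd (b q x : R) (n : nat) : snd (rp_pair b q x n) = rp b q x (S n).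
Proof. unfold rp; simpl; destruct (rp_pair b q x n); reflexivity. Qed.

Lemma rp_rec (b q x : R) (n : nat) : Rabs q < 1 ->
  (1 - q ^ S n) * rp b q x (S n) + lowered b q (rp b q x) n = 2 * x * (1 - b * q ^ n) * rp b q x n.
Proof.
  intros Hq; destruct n as [|n].
  - assert (H := one_minus_pow_pos q 0 Hq); unfold rp, lowered; simpl in *; field; lra.
  - assert (H := one_minus_pow_pos q (S n) Hq).
    unfold lowered; rewrite <- (rp_pair_snd b q x (S n)), <- (rp_pair_snd b q x n).
    cbn [rp_pair]; unfold rp; destruct (rp_pair b q x n) as [u v]; cbn [fst snd].
    field; lra.
Qed.

Lemma Csum_ext_le (u v : nat -> C) (n : nat) :
  (forall k, (k <= n)%nat -> u k = v k) -> sum_n u n = sum_n v n.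
Proof. exact (@sum_n_ext_loc C_AbelianMonoid u v n). Qed.

Lemma Csum_shift (u : nat -> C) (n : nat) :
  sum_n u (S n) = (u 0%nat + sum_n (fun k => u (S k)) n)%C.
Proof.
  induction n as [|n IH]; [rewrite Csum_S, !Csum_0; reflexivity|].
  rewrite Csum_S, IH, Csum_S; as_C; ring.
Qed.

Lemma Csum_mult (c : C) (u : nat -> C) (n : nat) :
  sum_n (fun k => c * u k)%C n = (c * sum_n u n)%C.
Proof.
  induction n as [|n IH]; [rewrite !Csum_0; reflexivity|].
  rewrite !Csum_S, IH; as_C; ring.
Qed.

Lemma Csum_plus (u v : nat -> C) (n : nat) :
  sum_n (fun k => u k + v k)%C n = (sum_n u n + sum_n v n)%C.
Proof.
  induction n as [|n IH]; [rewrite !Csum_0; reflexivity|].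
  rewrite !Csum_S, IH; as_C; ring.
Qed.

Section RogersSum.
Context (q b : R) (Hq : Rabs q < 1) (z zi : C) (Hz : (z * zi = 1)%C).

Notation c k := (RtoC (qb q 1 b k)).
Notation x k := (c k * z ^ k)%C.
Notation y k := (c k * zi ^ k)%C.

Definition rsum (n : nat) : C := sum_n (fun k => x k * y (n - k))%C n.
Definition rsumq (n : nat) : C := sum_n (fun k => q ^ k * (x k * y (n - k)))%C n.

Let cS (k : nat) : (c (S k) * (1 - q ^ S k) = c k * (1 - b * q ^ k))%C.
Proof.
  rewrite <- !RtoC_pow, <- RtoC_mult, <- !RtoC_minus, <- !RtoC_mult; f_equal; apply qb_S, Hq.
Qed.

Let low_part (n : nat) : (rsum (S n) - rsumq (S n) = z * (rsum n - b * rsumq n))%C.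
Proof.
  transitivity (sum_n (fun k => (1 - q ^ k) * (x k * y (S n - k)))%C (S n)).
  - unfold rsum, rsumq.
    replace (_ - _)%C with (sum_n (fun k => x k * y (S n - k))%C (S n)
      + RtoC (-1) * sum_n (fun k => q ^ k * (x k * y (S n - k)))%C (S n))%C by ring.
    rewrite <- Csum_mult, <- Csum_plus; apply Csum_ext_le; intros k _; ring.
  - rewrite Csum_shift; cbn [Cpow].
    unfold rsum, rsumq.
    replace (z * _)%C with (sum_n (fun k => z * ((1 - b * q ^ k) * (x k * y (n - k))))%C n).
    + match goal with |- (?h + ?s)%C = _ => replace h with (RtoC 0) by ring; rewrite Cplus_0_l end.
      apply Csum_ext_le; intros k _; cbn [Nat.sub].
      transitivity (z * z ^ k * (c (S k) * (1 - q ^ S k)) * y (n - k))%C; [rewrite !Cpow_S; ring|].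
      rewrite cS; ring.
    + rewrite Csum_mult; f_equal.
      replace (_ - _)%C with (sum_n (fun k => x k * y (n - k))%C n
        + (- b) * sum_n (fun k => q ^ k * (x k * y (n - k)))%C n)%C by ring.
      rewrite <- Csum_mult, <- Csum_plus; apply Csum_ext_le; intros k _; ring.
Qed.

Let high_part (n : nat) : (rsumq (S n) - q ^ S n * rsum (S n) = zi * (rsumq n - b * q ^ n * rsum n))%C.
Proof.
  transitivity (sum_n (fun k => (q ^ k - q ^ S n) * (x k * y (S n - k)))%C (S n)).
  - unfold rsum, rsumq.
    replace (_ - _)%C with (sum_n (fun k => q ^ k * (x k * y (S n - k)))%C (S n)
      + (- q ^ S n) * sum_n (fun k => x k * y (S n - k))%C (S n))%C by ring.
    rewrite <- Csum_mult, <- Csum_plus; apply Csum_ext_le; intros k _; ring.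
  - rewrite Csum_S; unfold rsum, rsumq.
    replace (zi * _)%C with (sum_n (fun k => zi * ((q ^ k - b * q ^ n) * (x k * y (n - k))))%C n).
    + match goal with |- (?s + ?h)%C = _ => replace h with (RtoC 0) by ring; rewrite Cplus_0_r end.
      apply Csum_ext_le; intros k Hk.
      replace (S n - k)%nat with (S (n - k)) by lia.
      replace (q ^ n)%C with (q ^ k * q ^ (n - k))%C by (rewrite <- Cpow_add_r; f_equal; lia).
      replace (q ^ S n)%C with (q ^ k * q ^ S (n - k))%C by (rewrite <- Cpow_add_r; f_equal; lia).
      transitivity (zi * zi ^ (n - k) * (c (S (n - k)) * (1 - q ^ S (n - k))) * q ^ k * x k)%C; [rewrite (Cpow_S zi); ring|].
      rewrite cS; ring.
    + rewrite Csum_mult; f_equal.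
      replace (_ - _)%C with (sum_n (fun k => q ^ k * (x k * y (n - k)))%C n
        + (- (b * q ^ n)) * sum_n (fun k => x k * y (n - k))%C n)%C by ring.
      rewrite <- Csum_mult, <- Csum_plus; apply Csum_ext_le; intros k _; ring.
Qed.

Lemma rsum_0 : rsum 0 = 1%C.
Proof. unfold rsum; rewrite Csum_0; cbn [qb Cpow Nat.sub]; ring. Qed.

Lemma rsumq_0 : rsumq 0 = 1%C.
Proof. unfold rsumq; rewrite Csum_0; cbn [qb Cpow Nat.sub]; ring. Qed.

Lemma rsum_1 : ((1 - q) * rsum 1 = (z + zi) * (1 - b))%C.
Proof.
  assert (H1 := low_part 0); assert (H2 := high_part 0); rewrite rsum_0, rsumq_0 in *.
  cbn [Cpow] in H2.
  transitivity ((rsum 1 - rsumq 1) + (rsumq 1 - q * 1 * rsum 1))%C; [ring|].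
  rewrite H1, H2; ring.
Qed.

Lemma rsum_rec (n : nat) :
  ((1 - q ^ S (S n)) * rsum (S (S n)) = (z + zi) * (1 - b * q ^ S n) * rsum (S n) - (1 - b ^ 2 * q ^ n) * rsum n)%C.
Proof.
  assert (L0 := low_part n); assert (H0 := high_part n).
  assert (L1 := low_part (S n)); assert (H1 := high_part (S n)).
  transitivity ((rsum (S (S n)) - rsumq (S (S n))) + (rsumq (S (S n)) - q ^ S (S n) * rsum (S (S n))))%C; [ring|].
  rewrite L1, H1.
  set (R1 := rsum (S n)) in *; set (Q1 := rsumq (S n)) in *; set (R0 := rsum n) in *; set (Q0 := rsumq n) in *.
  assert (E1 : Q1 = (q ^ S n * R1 + zi * (Q0 - b * q ^ n * R0))%C) by (rewrite <- H0; ring).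
  assert (E2 : R1 = (Q1 + z * (R0 - b * Q0))%C) by (rewrite <- L0; ring).
  assert (EQ : (zi * Q0 = (1 - q ^ S n) * R1 - z * R0 + b * z * Q0 + zi * (b * q ^ n * R0))%C).
  { transitivity (Q1 - q ^ S n * R1 + zi * (b * q ^ n * R0))%C; [rewrite E1; ring|].
    rewrite E2 at 2; rewrite E2; ring. }
  assert (Hzz : (z * zi * R0 = R0)%C) by (rewrite Hz; ring).
  assert (Hzq : (z * zi * Q0 = Q0)%C) by (rewrite Hz; ring).
  assert (EQ1 : (Q1 = R1 - z * R0 + b * z * Q0)%C) by (rewrite E2; ring).
  rewrite EQ1.
  transitivity ((z + zi) * (1 - b * q ^ S n) * R1 - (z * zi * R0) + b * (z * zi * Q0)
     - b * z * ((1 - q ^ S n) * R1 - z * R0 + b * z * Q0))%C; [ring|].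
  replace ((1 - q ^ S n) * R1 - z * R0 + b * z * Q0)%C with (zi * Q0 - zi * (b * q ^ n * R0))%C
    by (rewrite EQ; ring).
  transitivity ((z + zi) * (1 - b * q ^ S n) * R1 - (z * zi * R0) + b * (z * zi * Q0)
     - b * (z * zi * Q0) + b * b * q ^ n * (z * zi * R0))%C; [ring|].
  rewrite Hzz; ring.
Qed.

Lemma rsum_rp (ct : R) (n : nat) : (z + zi = 2 * ct)%C -> rsum n = RtoC (rp b q ct n).
Proof.
  intros Hct.
  assert (Hd : forall k, (1 - q ^ S k)%C <> RtoC 0).
  { intros k; rewrite <- RtoC_pow, <- RtoC_minus; intros E; apply RtoC_inj in E.
    assert (H := one_minus_pow_pos q k Hq); lra. }
  assert (Hcancel : forall d u v : C, d <> RtoC 0 -> (d * u = d * v)%C -> u = v).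
  { intros d u v H0 H; transitivity (/ d * (d * u))%C; [field; exact H0|]; rewrite H; field; exact H0. }
  assert (H : rsum n = RtoC (rp b q ct n) /\ rsum (S n) = RtoC (rp b q ct (S n))); [|apply H].
  induction n as [|n [IH1 IH2]].
  - split; [apply rsum_0|]; apply (Hcancel (1 - q ^ 1)%C); [apply Hd|].
    rewrite Cpow_1_r, rsum_1, Hct.
    assert (H := rp_rec b q ct 0 Hq); simpl in H; unfold rp at 2 in H; simpl in H.
    rewrite <- !RtoC_minus, <- !RtoC_mult; f_equal; lra.
  - split; [exact IH2|]; apply (Hcancel (1 - q ^ S (S n))%C); [apply Hd|].
    rewrite rsum_rec, Hct, IH1, IH2.
    assert (H := rp_rec b q ct (S n) Hq); unfold lowered in H.
    rewrite <- !RtoC_pow, <- !RtoC_mult, <- !RtoC_minus, <- !RtoC_mult, <- RtoC_minus; f_equal; lra.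
Qed.

Lemma Cmod_rsum_le (M : R) (n : nat) :
  (forall k, Rabs (qb q 1 b k) <= M) -> Cmod z = 1 -> Cmod zi = 1 ->
  Cmod (rsum n) <= INR (S n) * (M * M).
Proof.
  intros HM H1 H2; rewrite <- sum_n_const.
  assert (Hterm : forall k j, Cmod (x k * y j)%C <= M * M).
  { intros k j; rewrite !Cmod_mult, !Cmod_R, !Cmod_pow, H1, H2, !pow1, !Rmult_1_r.
    apply Rmult_le_compat; auto using Rabs_pos. }
  unfold rsum.
  assert (H : forall m, Cmod (sum_n (fun k => x k * y (n - k))%C m) <= sum_n (fun _ => M * M) m); [|apply H].
  intros m; induction m as [|m IH].
  - rewrite Csum_0, sum_O; apply Hterm.
  - rewrite Csum_S, sum_Sn; eapply Rle_trans; [apply Cmod_triangle|].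
    apply Rplus_le_compat; [exact IH | apply Hterm].
Qed.

End RogersSum.

Lemma expi_plus (u v : R) : (expi u * expi v)%C = expi (u + v).
Proof. unfold expi, Cmult; simpl; rewrite cos_plus, sin_plus; f_equal; ring. Qed.

Lemma expi_0 : expi 0 = RtoC 1.
Proof. unfold expi; rewrite cos_0, sin_0; reflexivity. Qed.

Lemma expi_pow (u : R) (n : nat) : (expi u ^ n)%C = expi (INR n * u).
Proof.
  induction n as [|n IH]; [rewrite Rmult_0_l, expi_0; reflexivity|].
  rewrite Cpow_S, IH, expi_plus, S_INR; f_equal; ring.
Qed.

Lemma expi_opp (u : R) : (expi u * expi (- u) = 1)%C.
Proof. rewrite expi_plus, Rplus_opp_r; apply expi_0. Qed.

Lemma expi_sum (u : R) : (expi u + expi (- u) = 2 * cos u)%C.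
Proof. unfold expi, Cplus, Cmult, RtoC; simpl; rewrite cos_neg, sin_neg; f_equal; ring. Qed.

Lemma Cmod_expi (u : R) : Cmod (expi u) = 1.
Proof.
  unfold Cmod, expi; simpl; rewrite !Rmult_1_r.
  replace (cos u * cos u + sin u * sin u) with 1; [apply sqrt_1|].
  assert (H := sin2_cos2 u); unfold Rsqr in H; lra.
Qed.

Lemma Clim_eventually_const (u : nat -> C) (l : C) (N : nat) :
  (forall n, (N <= n)%nat -> u n = l) -> Clim u l.
Proof.
  intros H; apply is_lim_seq_ext_loc with (fun _ => 0); [|apply is_lim_seq_const].
  exists N; intros n Hn; rewrite H by exact Hn.
  replace (l - l)%C with (RtoC 0) by ring; rewrite Cmod_0; reflexivity.
Qed.

Lemma Csum_eventually_0 (u : nat -> C) (n m : nat) :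
  (forall k, (n < k)%nat -> u k = RtoC 0) -> (n <= m)%nat -> sum_n u m = sum_n u n.
Proof.
  intros Hu Hm; induction Hm as [|m Hm IH]; [reflexivity|].
  rewrite Csum_S, IH, Hu by lia; as_C; ring.
Qed.

Section RogersDef.
Context (q g : R) (Hq : 0 < Rabs q < 1) (Hg : -1 < g < 1) (Hg0 : g <> 0).

Let Hq0 : RtoC q <> RtoC 0.
Proof. intros E; apply RtoC_inj in E; rewrite E, Rabs_R0 in Hq; lra. Qed.

Let Hg1 : Rabs g < 1.
Proof. apply Rabs_def1; lra. Qed.

Let Hgc : RtoC g <> RtoC 0.
Proof. intros E; apply RtoC_inj in E; auto. Qed.

Let one_minus_Cpow (a : R) (k : nat) : Rabs a < 1 -> (1 - a * q ^ k)%C <> RtoC 0.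
Proof.
  intros Ha; rewrite <- RtoC_pow, <- RtoC_mult, <- RtoC_minus; intros E; apply RtoC_inj in E.
  assert (H := one_minus_pos a q k (proj2 Hq) Ha); lra.
Qed.

Let Cpowz_neg (n : nat) : Cpowz q (- Z.of_nat n) = (/ q ^ n)%C.
Proof.
  destruct n as [|n]; [simpl; field; apply C1_nz|].
  simpl Z.of_nat; simpl Z.opp; unfold Cpowz; rewrite SuccNat2Pos.id_succ; reflexivity.
Qed.

Let Cpowz_1_minus (n : nat) : Cpowz q (1 - Z.of_nat n) = (q / q ^ n)%C.
Proof.
  destruct n as [|n]; [simpl; field; apply C1_nz|].
  replace (1 - Z.of_nat (S n))%Z with (- Z.of_nat n)%Z by lia.
  rewrite Cpowz_neg, Cpow_S; field; split; [apply Cpow_nz|]; exact Hq0.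
Qed.

Let qpoch_qb (k : nat) : (qpoch g q k / qpoch q q k)%C = RtoC (qb q 1 g k).
Proof.
  induction k as [|k IH]; [cbn [qpoch qb]; field; apply C1_nz|].
  assert (H1 := qpoch_neq_0 q (proj2 Hq) q k); rewrite Cmod_R in H1.
  assert (H2 := one_minus_Cpow q k (proj2 Hq)).
  assert (H3 := one_minus_pow_pos q k (proj2 Hq)).
  cbn [qpoch qb]; rewrite RtoC_div by lra; rewrite RtoC_mult, <- IH, !RtoC_minus, RtoC_mult, !RtoC_pow, Cpow_S.
  field; split; auto; apply H1; exact (proj2 Hq).
Qed.

Let qpoch_top_0 (n k : nat) : (n < k)%nat -> qpoch (/ q ^ n)%C q k = RtoC 0.
Proof.
  intros H; induction H as [|k H IH]; cbn [qpoch]; [|rewrite IH; ring].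
  replace (1 - / q ^ n * q ^ n)%C with (RtoC 0); [ring|].
  field; apply Cpow_nz, Hq0.
Qed.

Let bottom_factor (n k : nat) : (k < n)%nat -> (1 - / g * (q / q ^ n) * q ^ k)%C <> RtoC 0.
Proof.
  intros H E.
  apply (one_minus_Cpow g (n - S k) Hg1).
  replace (q ^ n)%C with (q * (q ^ k * q ^ (n - S k)))%C in E
    by (rewrite <- Cpow_add_r, <- Cpow_S; f_equal; lia).
  assert (H1 : (q ^ k)%C <> RtoC 0) by (apply Cpow_nz, Hq0).
  assert (H2 : (q ^ (n - S k))%C <> RtoC 0) by (apply Cpow_nz, Hq0).
  transitivity (- (g * q ^ (n - S k)) * (1 - / g * (q / (q * (q ^ k * q ^ (n - S k)))) * q ^ k))%C;
    [field; auto | rewrite E; ring].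
Qed.

Let qpoch_bottom (n k : nat) : (k <= n)%nat -> qpoch (/ g * (q / q ^ n))%C q k <> RtoC 0.
Proof.
  intros H; induction k as [|k IH]; [apply C1_nz|].
  cbn [qpoch]; apply Cmult_neq_0; [apply IH; lia | apply bottom_factor; lia].
Qed.

Let term (n : nat) (w : C) (k : nat) : C :=
  (qpoch (/ q ^ n) q k * qpoch g q k / (qpoch q q k * qpoch (/ g * (q / q ^ n)) q k) * (q * / g * w) ^ k)%C.

Let term_eq (n : nat) (w : C) (k : nat) : (k <= n)%nat ->
  (RtoC (qb q 1 g n) * term n w k = RtoC (qb q 1 g k) * RtoC (qb q 1 g (n - k)) * w ^ k)%C.
Proof.
  intros Hk; induction k as [|k IH].
  - rewrite Nat.sub_0_r; unfold term; cbn [qpoch Cpow qb]; field; apply C1_nz.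
  - assert (Hqk := qpoch_neq_0 q (proj2 Hq) q k); rewrite Cmod_R in Hqk; specialize (Hqk (proj2 Hq)).
    assert (Hbk := qpoch_bottom n k ltac:(lia)).
    assert (Hb := bottom_factor n k ltac:(lia)).
    assert (H1 := one_minus_Cpow q k (proj2 Hq)).
    assert (H2 := one_minus_Cpow q (n - S k) (proj2 Hq)).
    assert (H3 := one_minus_Cpow g (n - S k) Hg1).
    assert (Hqn : (q ^ n)%C <> RtoC 0) by (apply Cpow_nz, Hq0).
    transitivity ((RtoC (qb q 1 g n) * term n w k)
      * ((1 - / q ^ n * q ^ k) * (1 - g * q ^ k)
         / ((1 - q * q ^ k) * (1 - / g * (q / q ^ n) * q ^ k)) * (q * / g * w)))%C.
    { unfold term; cbn [qpoch]; rewrite Cpow_S; field; repeat split; auto.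
      intros E; apply Hb; transitivity ((g * q ^ n - q * q ^ k) / (g * q ^ n))%C; [field; auto|].
      rewrite E; field; auto. }
    rewrite IH by lia.
    assert (Ek : RtoC (qb q 1 g (S k)) = (RtoC (qb q 1 g k) * (1 - g * q ^ k) / (1 - q * q ^ k))%C).
    { assert (E := qb_S q 1 g k (proj2 Hq)); apply (f_equal RtoC) in E.
      rewrite !RtoC_mult, !RtoC_minus, RtoC_mult, !RtoC_pow, Cpow_S in E.
      rewrite <- E; field; exact H1. }
    assert (En : RtoC (qb q 1 g (n - k)) = (RtoC (qb q 1 g (n - S k)) * (1 - g * q ^ (n - S k)) / (1 - q * q ^ (n - S k)))%C).
    { assert (E := qb_S q 1 g (n - S k) (proj2 Hq)); apply (f_equal RtoC) in E.
      rewrite !RtoC_mult, !RtoC_minus, RtoC_mult, !RtoC_pow, Cpow_S in E.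
      replace (S (n - S k)) with (n - k)%nat in E by lia.
      rewrite <- E; field; exact H2. }
    rewrite Ek, En, Cpow_S.
    assert (Eqn : (q ^ n)%C = (q * (q ^ k * q ^ (n - S k)))%C)
      by (rewrite <- Cpow_add_r, <- Cpow_S; f_equal; lia).
    assert (Hqk' : (q ^ k)%C <> RtoC 0) by (apply Cpow_nz, Hq0).
    assert (Hqnk : (q ^ (n - S k))%C <> RtoC 0) by (apply Cpow_nz, Hq0).
    replace (1 - / q ^ n * q ^ k)%C with (- (1 - q * q ^ (n - S k)) / (q * q ^ (n - S k)))%C
      by (rewrite Eqn; field; auto).
    replace (1 - / g * (q / q ^ n) * q ^ k)%C with (- (1 - g * q ^ (n - S k)) / (g * q ^ (n - S k)))%C
      by (rewrite Eqn; field; auto).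
    field; repeat split; auto.
    all: intros E; apply H3; transitivity (- - (1 - g * q ^ (n - S k)))%C; [ring|]; rewrite E; ring.
Qed.

Lemma rogers_rp (theta : R) (n : nat) : 0 <= theta <= PI ->
  rogers n (cos theta) g q = RtoC (rp g q (cos theta) n).
Proof.
  intros Ht; unfold rogers; rewrite acos_cos by exact Ht.
  set (w := expi (- (2 * theta))).
  assert (Hb : bhs [Cpowz q (- Z.of_nat n); RtoC g] [(/ g * Cpowz q (1 - Z.of_nat n))%C] q (q * / g * w)%C
    = sum_n (term n w) n).
  { apply CLim_seq_Clim, (Clim_eventually_const _ _ n); intros m Hm.
    rewrite <- (Csum_eventually_0 (term n w) n m); [|intros k Hk; unfold term; rewrite qpoch_top_0 by exact Hk; unfold Cdiv; ring | exact Hm].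
    apply Csum_ext_le; intros k _; rewrite Cpowz_neg, Cpowz_1_minus.
    unfold qpochs, term; cbn [fold_right length Z.of_nat Pos.of_succ_nat Pos.succ Z.add Z.sub Z.opp Z.pos_sub Pos.add Cpowz Pos.pred_double].
    simpl Cpowz; rewrite !Cmult_1_r; reflexivity. }
  rewrite Hb, qpoch_qb.
  rewrite <- (rsum_rp q g (proj2 Hq) (expi (- theta)) (expi theta)).
  - transitivity (expi (INR n * theta) * (RtoC (qb q 1 g n) * sum_n (term n w) n))%C; [ring|].
    rewrite <- !Csum_mult; apply Csum_ext_le; intros k Hk.
    rewrite term_eq by exact Hk; unfold w.
    transitivity (RtoC (qb q 1 g k) * RtoC (qb q 1 g (n - k)) * (expi (INR n * theta) * expi (- (2 * theta)) ^ k))%C; [ring|].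
    transitivity (RtoC (qb q 1 g k) * RtoC (qb q 1 g (n - k)) * (expi (- theta) ^ k * expi theta ^ (n - k)))%C; [|ring].
    f_equal; rewrite !expi_pow, !expi_plus, minus_INR by exact Hk; f_equal; ring.
  - rewrite Cmult_comm; apply expi_opp.
  - rewrite Cplus_comm; apply expi_sum.
Qed.

End RogersDef.

Lemma INR_pow_bound (s : R) (n : nat) : 0 <= s < 1 -> INR (S n) * s ^ n <= / (1 - s).
Proof.
  intros Hs; eapply Rle_trans; [|apply (sum_geom_le s n Hs)].
  rewrite <- sum_n_const, !sum_n_Reals; apply sum_Rle; intros k Hk.
  replace n with (k + (n - k))%nat by lia; rewrite pow_add.
  rewrite <- (Rmult_1_r (s ^ k)) at 2; apply Rmult_le_compat_l; [apply pow_le; lra|].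
  rewrite <- (pow1 (n - k)); apply pow_incr; lra.
Qed.

Lemma ex_series_INR_pow (M r : R) : 0 <= r < 1 -> ex_series (fun k => INR (S k) * M * r ^ k).
Proof.
  intros Hr; set (s := sqrt r).
  assert (Hs : 0 <= s < 1) by (split; [apply sqrt_pos | rewrite <- sqrt_1; apply sqrt_lt_1; lra]).
  assert (Hss : forall k, r ^ k = s ^ k * s ^ k) by (intros k; rewrite <- Rpow_mult_distr; f_equal; unfold s; rewrite sqrt_sqrt; lra).
  apply (ex_series_le (K := R_AbsRing) (V := R_CompleteNormedModule)) with (fun k => / (1 - s) * Rabs M * s ^ k).
  - intros k; change (norm ?x) with (Rabs x); rewrite Hss, !Rabs_mult.
    assert (Hk : 0 <= s ^ k) by (apply pow_le; lra).
    rewrite !(Rabs_pos_eq (s ^ k)) by exact Hk; rewrite (Rabs_pos_eq (INR _)) by apply pos_INR.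
    assert (H := INR_pow_bound s k Hs).
    replace (INR (S k) * Rabs M * (s ^ k * s ^ k)) with (INR (S k) * s ^ k * (Rabs M * s ^ k)) by ring.
    rewrite (Rmult_assoc (/ (1 - s))); apply Rmult_le_compat_r; [|exact H].
    apply Rmult_le_pos; [apply Rabs_pos | exact Hk].
  - apply ex_series_scal_geom; rewrite Rabs_pos_eq; lra.
Qed.

Lemma rp_bound (q b : R) : Rabs q < 1 ->
  exists M, 0 < M /\ forall theta n, Rabs (rp b q (cos theta) n) <= INR (S n) * M.
Proof.
  intros Hq; destruct (qb_bound q b 1 Hq Rlt_0_1) as [M [HM H]].
  exists (M * M); split; [apply Rmult_lt_0_compat; exact HM|]; intros theta n.
  rewrite <- Cmod_R, <- (rsum_rp q b Hq (expi theta) (expi (- theta)) (expi_opp theta) _ n (expi_sum theta)).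
  apply Cmod_rsum_le; try apply Cmod_expi.
  intros k; eapply Rle_trans; [apply H; rewrite Rabs_R1; lra | rewrite pow1; lra].
Qed.

Lemma rogers_generating (q b theta : R) (t : C) (B : nat -> R) :
  Rabs q < 1 -> ex_series B ->
  (forall k, Cmod (RtoC (rp b q (cos theta) k) * t ^ k)%C <= B k) ->
  (cps (fun k => RtoC (rp b q (cos theta) k)) t
     * (qpoch_inf (t * expi theta) q * qpoch_inf (t * expi (- theta)) q)
   = qpoch_inf (t * b * expi theta) q * qpoch_inf (t * b * expi (- theta)) q)%C.
Proof.
  intros Hq HB Hs.
  set (e := expi theta) in *; set (e' := expi (- theta)) in *.
  assert (Hee : (e * e' = 1)%C) by apply expi_opp.
  assert (Hsum : (e + e' = 2 * cos theta)%C) by apply expi_sum.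
  set (s := fun k => RtoC (rp b q (cos theta) k)) in *.
  transitivity (qpoch_inf (t * b * e) q * qpoch_inf (t * b * e') q * s 0%nat)%C;
    [|unfold s, rp; cbn [rp_pair fst]; ring].
  apply (cps_product q Hq s B t HB Hs (fun w => (1 - w * e) * (1 - w * e'))%C
    (fun w => (1 - w * b * e) * (1 - w * b * e'))%C
    (fun N => qpoch (t * e) q N * qpoch (t * e') q N)%C
    (fun N => qpoch (t * b * e) q N * qpoch (t * b * e') q N)%C).
  - intros N; set (w := (q ^ N * t)%C).
    replace (q ^ S N * t)%C with (q ^ 1 * w)%C by (unfold w; rewrite Cpow_1_r, Cpow_S; ring).
    assert (Hw : forall k, Cmod (s k * w ^ k)%C <= B k).
    { intros k; unfold w; rewrite Cpow_mult_l.
      replace (s k * ((q ^ N) ^ k * t ^ k))%C with ((q ^ N) ^ k * (s k * t ^ k))%C by ring.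
      rewrite Cmod_mult, !Cmod_pow, Cmod_R, <- (Rmult_1_l (B k)).
      apply Rmult_le_compat; [apply pow_le, pow_le, Rabs_pos | apply Cmod_ge_0 | | apply Hs].
      rewrite <- pow_mult, RPow_abs; apply Rabs_pow_le_1, Hq. }
    assert (Hf : forall v, ((1 - v * e) * (1 - v * e') = 1 - 2 * cos theta * v + v * v)%C).
    { intros v; transitivity (1 - (e + e') * v + (e * e') * (v * v))%C; [ring|]; rewrite Hee, Hsum; ring. }
    assert (Hg : ((1 - w * b * e) * (1 - w * b * e') = 1 - 2 * cos theta * (b * w) + (b * w) * (b * w))%C).
    { rewrite <- Hf; ring. }
    rewrite Hf, Hg; clear Hf Hg.
    set (P := fun n => sum_n (fun k => s k * w ^ k)%C n).
    set (Q := fun n => sum_n (fun k => s k * (q ^ 1 * w) ^ k)%C n).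
    assert (Hrec : forall n, ((1 - q ^ S (S n)) * s (S (S n)) + (1 - b * b * q ^ n) * s n
        = 2 * cos theta * (1 - b * q ^ S n) * s (S n))%C).
    { intros n; assert (H := rp_rec b q (cos theta) (S n) Hq); unfold lowered in H; unfold s.
      rewrite <- !RtoC_pow, <- !RtoC_mult, <- !RtoC_minus, <- !RtoC_mult, <- RtoC_plus; f_equal; lra. }
    assert (H1 : ((1 - q) * s 1%nat = 2 * cos theta * (1 - b))%C).
    { assert (H := rp_rec b q (cos theta) 0 Hq); simpl in H; unfold rp at 2 in H; simpl in H.
      unfold s; rewrite <- !RtoC_minus, <- !RtoC_mult; f_equal; lra. }
    assert (Hfin : forall n, ((1 - 2 * cos theta * w + w * w) * P n
        - (1 - 2 * cos theta * (b * w) + (b * w) * (b * w)) * Q n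
        = (1 - b * b * q ^ n) * w * w * (s n * w ^ n) - (1 - q ^ S n) * (s (S n) * w ^ S n))%C).
    { intros n; induction n as [|n IH].
      - unfold P, Q; rewrite !Csum_0; cbn [Cpow].
        transitivity (s 0%nat * ((1 - b * b) * w * w) - s 0%nat * w * (2 * cos theta * (1 - b)))%C; [ring|].
        rewrite <- H1; unfold s at 1 2 4; cbn [rp rp_pair fst]; unfold rp; cbn [rp_pair fst]; ring.
      - assert (EP : (P (S n) = P n + s (S n) * w ^ S n)%C) by apply Csum_S.
        assert (EQ : (Q (S n) = Q n + s (S n) * (q ^ 1 * w) ^ S n)%C) by apply Csum_S.
        rewrite EP, EQ, Cpow_mult_l, Cpow_1_r.
        transitivity ((1 - 2 * cos theta * w + w * w) * P n
          - (1 - 2 * cos theta * (b * w) + (b * w) * (b * w)) * Q n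
          + (1 - q ^ S n) * (s (S n) * w ^ S n)
          + (1 - b * b * q ^ S n) * w * w * (s (S n) * w ^ S n)
          - w * w ^ S n * (2 * cos theta * (1 - b * q ^ S n) * s (S n)))%C; [ring|].
        rewrite IH, <- Hrec, !(Cpow_S w); ring. }
    assert (HL : Clim (fun n => (1 - 2 * cos theta * w + w * w) * P n
        - (1 - 2 * cos theta * (b * w) + (b * w) * (b * w)) * Q n)%C
        ((1 - 2 * cos theta * w + w * w) * cps s w
        - (1 - 2 * cos theta * (b * w) + (b * w) * (b * w)) * cps s (q ^ 1 * w))%C).
    { apply Clim_minus; apply Clim_mult; try apply Clim_const.
      - apply Clim_sum_of_bound with B; assumption.
      - apply (Clim_cps_scaled q Hq s B w HB Hw 1). }
    assert (HB0 := ex_series_lim_0 B HB).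
    assert (Hs0 : Clim (fun n => s n * w ^ n)%C 0) by (apply Clim_0_of_bound with B; assumption).
    assert (Hqn : Clim (fun n => q ^ n)%C 0).
    { apply Clim_0_of_bound with (fun n => Rabs q ^ n); [intros; rewrite Cmod_pow, Cmod_R; lra|].
      apply is_lim_seq_geom; rewrite Rabs_Rabsolu; exact Hq. }
    assert (Hinc : forall u l, Clim u l -> Clim (fun n => u (S n)) l).
    { intros u l Hu; apply -> (is_lim_seq_incr_1 (fun n => Cmod (u n - l)%C)); exact Hu. }
    assert (HL0 : Clim (fun n => (1 - 2 * cos theta * w + w * w) * P n
        - (1 - 2 * cos theta * (b * w) + (b * w) * (b * w)) * Q n)%C 0).
    { eapply Clim_ext; [intros n; symmetry; apply Hfin|].
      replace (RtoC 0) with ((1 - b * b * 0) * w * w * 0 - (1 - 0) * 0)%C by ring.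
      apply Clim_minus; apply Clim_mult.
      - apply Clim_mult; [apply Clim_mult|]; try apply Clim_const.
        apply Clim_minus; [apply Clim_const|]; apply Clim_mult; [apply Clim_const | exact Hqn].
      - exact Hs0.
      - apply Clim_minus; [apply Clim_const | apply (Hinc (fun n => q ^ n)%C), Hqn].
      - apply (Hinc (fun n => s n * w ^ n)%C), Hs0. }
    assert (HE := Clim_unique _ _ _ HL HL0).
    match type of HE with (?x - ?y)%C = _ => transitivity (x - y + y)%C; [ring | rewrite HE; ring] end.
  - cbn [qpoch]; ring.
  - cbn [qpoch]; ring.
  - intros N; cbn [qpoch]; ring.
  - intros N; cbn [qpoch]; ring.
  - apply Clim_mult; apply Clim_qpoch, Hq.
  - apply Clim_mult; apply Clim_qpoch, Hq.
Qed.

(** * Total mass of the weight *)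

Lemma qb_shift (q g : R) (k : nat) : Rabs q < 1 ->
  qb q (q * g) 1 (S k) = qb q g 1 (S k) - g * qb q g 1 k.
Proof.
  intros Hq.
  assert (H : forall k, qb q (q * g) 1 (S k) * (1 - q ^ S k) = (q * g - 1) * q ^ k * qb q g 1 k).
  { intros j; induction j as [|j IH].
    - rewrite qb_S by exact Hq; simpl; ring.
    - assert (Hj := one_minus_pow_pos q j Hq).
      rewrite qb_S by exact Hq.
      apply Rmult_eq_reg_r with (1 - q ^ S j); [|lra].
      transitivity ((qb q (q * g) 1 (S j) * (1 - q ^ S j)) * (q * (g - q ^ j))); [cbn [pow]; ring|].
      rewrite IH; transitivity ((q * g - 1) * q ^ S j * (qb q g 1 j * (g - 1 * q ^ j))); [cbn [pow]; ring|].
      rewrite <- (qb_S q g 1 j Hq); ring. }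
  assert (Hk := one_minus_pow_pos q k Hq).
  apply Rmult_eq_reg_r with (1 - q ^ S k); [|lra].
  transitivity (qb q g 1 (S k) * (1 - q ^ S k) - g * qb q g 1 k * (1 - q ^ S k)); [|ring].
  rewrite H, qb_S by exact Hq; cbn [pow]; ring.
Qed.

Lemma qb_base (q g : R) (k : nat) : Rabs q < 1 ->
  qb q g 1 (S k) * (1 - q ^ S k) = (g - 1) * qb q g q k.
Proof.
  intros Hq; induction k as [|k IH]; [rewrite qb_S by exact Hq; simpl; ring|].
  assert (Hk := one_minus_pow_pos q k Hq).
  rewrite qb_S by exact Hq; apply Rmult_eq_reg_r with (1 - q ^ S k); [|lra].
  transitivity ((qb q g 1 (S k) * (1 - q ^ S k)) * (g - q ^ S k)); [ring|].
  rewrite IH; transitivity ((g - 1) * (qb q g q (S k) * (1 - q ^ S k))); [rewrite qb_S by exact Hq; cbn [pow]; ring | ring].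
Qed.

Lemma omega_0_scale (q g : R) : 0 < Rabs q < 1 -> Rabs g < 1 ->
  omega q (q * g) 0 * (1 - g * q) = omega q g 0 * ((1 + g) * (1 - g ^ 2 * q)).
Proof.
  intros Hq Hg.
  set (a := qb q g 1).
  set (b := fun k => match k with O => 0 | S j => a j end).
  assert (H0 := is_series_omega q g Hq Hg 0); assert (H1 := is_series_omega q g Hq Hg 1).
  assert (Hb0 : is_series (fun k => b k * b k) (omega q g 0)).
  { apply is_series_drop with 1%nat; [intros k Hk; replace k with 0%nat by lia; simpl; ring|].
    apply is_series_ext with (2 := H0); intros k; rewrite Nat.add_0_r; reflexivity. }
  assert (Hb1 : is_series (fun k => b k * a k) (omega q g 1)).
  { apply is_series_drop with 1%nat; [intros k Hk; replace k with 0%nat by lia; simpl; ring|].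
    apply is_series_ext with (2 := H1); intros k; rewrite Nat.add_1_r; reflexivity. }
  assert (Hs : omega q (q * g) 0 = omega q g 0 + g ^ 2 * omega q g 0 - 2 * g * omega q g 1).
  { unfold omega at 1; apply is_series_unique.
    apply is_series_ext with (fun k => a k * a (k + 0)%nat + g ^ 2 * (b k * b k) - 2 * g * (b k * a k)).
    - intros k; rewrite Nat.add_0_r; as_R; destruct k as [|k]; [unfold a, b; simpl; ring|].
      rewrite qb_shift by apply Hq; unfold b, a; ring.
    - apply is_series_Rminus; [apply is_series_Rplus|]; auto using is_series_Rscal. }
  assert (H := omega_1 q g Hq Hg).
  rewrite Hs; transitivity (omega q g 0 * (1 + g ^ 2) * (1 - g * q) - g * (omega q g 1 * (1 - g * q) * 2)); [ring|].
  rewrite H; ring.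
Qed.

Lemma Rabs_pow_scale (q g : R) (N : nat) : Rabs q < 1 -> Rabs (q ^ N * g) <= Rabs g.
Proof.
  intros Hq; rewrite Rabs_mult; assert (H := Rabs_pow_le_1 q N Hq).
  assert (H0 := Rabs_pos g); nra.
Qed.

Lemma omega_0_iter (q g : R) (N : nat) : 0 < Rabs q < 1 -> Rabs g < 1 ->
  omega q (q ^ N * g) 0 * (rpoch g q N * rpoch (g * q) q N) = omega q g 0 * rpoch (g ^ 2) q (2 * N).
Proof.
  intros Hq Hg; induction N as [|N IH]; [simpl; rewrite Rmult_1_l; ring|].
  replace (2 * S N)%nat with (S (S (2 * N))) by lia.
  assert (H := omega_0_scale q (q ^ N * g) Hq (Rle_lt_trans _ _ _ (Rabs_pow_scale q g N (proj2 Hq)) Hg)).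
  replace (q ^ S N * g) with (q * (q ^ N * g)) by (cbn [pow]; ring).
  cbn [rpoch].
  transitivity (omega q (q * (q ^ N * g)) 0 * (1 - q ^ N * g * q) * (rpoch g q N * rpoch (g * q) q N) * (1 - g * q ^ N)); [ring|].
  rewrite H.
  transitivity ((omega q (q ^ N * g) 0 * (rpoch g q N * rpoch (g * q) q N))
    * ((1 + q ^ N * g) * (1 - (q ^ N * g) ^ 2 * q) * (1 - g * q ^ N))); [ring|].
  rewrite IH; replace (2 * N)%nat with (N + N)%nat by lia; cbn [pow]; rewrite !pow_add; ring.
Qed.

Lemma continuous_qb (q b x : R) (k : nat) : continuous (fun y => qb q y b k) x.
Proof.
  induction k as [|k IH]; [apply continuous_const|].
  apply continuous_ext with (fun y => qb q y b k * ((y + - (b * q ^ k)) * / (1 - q ^ S k))).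
  { intros y; cbn [qb]; unfold Rdiv; as_R; ring. }
  apply continuous_Rmult; [exact IH|].
  apply continuous_Rmult; [apply continuous_Rplus; [apply continuous_id|]|]; apply continuous_const.
Qed.

Lemma omega_0_lim (q g : R) : 0 < Rabs q < 1 -> Rabs g < 1 ->
  is_lim_seq (fun N => omega q (q ^ N * g) 0) (omega q 0 0).
Proof.
  intros Hq Hg.
  destruct (qb_bound q 1 (/ 2) (proj2 Hq)) as [M [HM H]]; [lra|].
  assert (Hc : continuous (fun y => omega q y 0) 0).
  { apply continuous_Series with (fun k => M * M * (/ 4) ^ k).
    - intros k; apply continuous_Rmult; apply continuous_qb.
    - exists (mkposreal (/ 2) ltac:(lra)); intros y Hy k.
      assert (Hy' : Rabs y <= / 2).
      { assert (Hy0 : Rabs (y - 0) < / 2) by exact Hy; rewrite Rminus_0_r in Hy0; lra. }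
      rewrite Nat.add_0_r, Rabs_mult.
      replace (/ 4) with (/ 2 * / 2) by field; rewrite Rpow_mult_distr.
      replace (M * M * ((/ 2) ^ k * (/ 2) ^ k)) with ((M * (/ 2) ^ k) * (M * (/ 2) ^ k)) by ring.
      apply Rmult_le_compat; auto using Rabs_pos.
    - apply ex_series_scal_geom; rewrite Rabs_pos_eq; lra. }
  assert (Hl : is_lim_seq (fun N => q ^ N * g) 0).
  { replace (Finite 0) with (Rbar_mult 0 g) by (simpl; f_equal; ring).
    apply is_lim_seq_scal_r, is_lim_seq_geom, Hq. }
  exact (filterlim_comp _ _ _ (fun N => q ^ N * g) (fun y => omega q y 0) _ _ _ Hl Hc).
Qed.

Lemma omega_q_q (q : R) : 0 < Rabs q < 1 -> omega q q 0 = 2.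
Proof.
  intros Hq; unfold omega; apply is_series_unique.
  assert (Hd := one_minus_pow_pos q 0 (proj2 Hq)); rewrite pow_1 in Hd.
  assert (H0 : forall k, qb q q 1 (S (S k)) = 0).
  { intros k; induction k as [|k IH].
    - cbn [qb pow]; replace (q - 1 * (q * 1)) with 0 by ring; unfold Rdiv; ring.
    - change (qb q q 1 (S (S (S k)))) with (qb q q 1 (S (S k)) * (q - 1 * q ^ S (S k)) / (1 - q ^ S (S (S k)))).
      rewrite IH; unfold Rdiv; ring. }
  assert (H1 : qb q q 1 1 = -1) by (simpl; field; lra).
  set (u := fun k => qb q q 1 k * qb q q 1 (k + 0)).
  apply is_series_ext with (fun k => (if Nat.eqb k 0 then 1 else 0) + (if Nat.eqb k 1 then 1 else 0)).
  - intros [|[|k]]; as_R; unfold u; rewrite Nat.add_0_r; [simpl; ring | rewrite H1; simpl; ring | rewrite H0; simpl; ring].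
  - replace 2 with (1 + 1) by ring; apply is_series_Rplus.
    + apply (is_series_single (fun k => if Nat.eqb k 0 then 1 else 0) 0).
      intros k Hk; rewrite (proj2 (Nat.eqb_neq k 0)) by exact Hk; reflexivity.
    + apply (is_series_single (fun k => if Nat.eqb k 1 then 1 else 0) 1).
      intros k Hk; rewrite (proj2 (Nat.eqb_neq k 1)) by exact Hk; reflexivity.
Qed.

Lemma Clim_RtoC (u : nat -> R) (l : R) : is_lim_seq u l -> Clim (fun n => RtoC (u n)) (RtoC l).
Proof. intros H; apply Clim_of_parts; [exact H | apply is_lim_seq_const]. Qed.

Lemma Rabs_lt_1_mult (a b : R) : Rabs a < 1 -> Rabs b < 1 -> Rabs (a * b) < 1.
Proof.
  intros Ha Hb; rewrite Rabs_mult; assert (H := Rabs_pos a); assert (H' := Rabs_pos b); nra.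
Qed.

Lemma omega_0_lim_eq (q g : R) : 0 < Rabs q < 1 -> Rabs g < 1 ->
  (omega q 0 0 * (qpoch_inf g q * qpoch_inf (g * q) q) = omega q g 0 * qpoch_inf (g ^ 2) q)%C.
Proof.
  intros Hq Hg.
  apply Clim_unique with (fun N => RtoC (omega q (q ^ N * g) 0) * (qpoch g q N * qpoch (g * q) q N))%C.
  - apply Clim_mult; [apply Clim_RtoC, omega_0_lim; assumption|].
    apply Clim_mult; apply Clim_qpoch, Hq.
  - apply Clim_ext with (fun N => RtoC (omega q g 0) * qpoch (g ^ 2) q (2 * N))%C.
    + intros N; rewrite <- RtoC_pow, <- RtoC_mult, !qpoch_RtoC, <- !RtoC_mult.
      f_equal; symmetry; apply omega_0_iter; assumption.
    + apply Clim_mult; [apply Clim_const|].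
      apply (Clim_subseq (qpoch (g ^ 2) q)); [intros; lia | apply Clim_qpoch, Hq].
Qed.

Lemma omega_0_closed (q g : R) : 0 < Rabs q < 1 -> Rabs g < 1 ->
  (omega q g 0 * (qpoch_inf (g ^ 2) q * qpoch_inf q q) = 2 * (qpoch_inf g q * qpoch_inf (g * q) q))%C.
Proof.
  intros Hq Hg.
  assert (Hq2 : (q ^ 2 = q * q)%C) by (cbn [Cpow]; ring).
  assert (E := omega_0_lim_eq q q Hq (proj2 Hq)); rewrite omega_q_q, Hq2 in E by exact Hq.
  assert (Hn : qpoch_inf (q * q) q <> RtoC 0).
  { apply qpoch_inf_neq_0; [apply Hq|]; rewrite <- RtoC_mult, Cmod_R; apply Rabs_lt_1_mult; apply Hq. }
  assert (E' : (omega q 0 0 * qpoch_inf q q = 2)%C).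
  { transitivity (omega q 0 0 * (qpoch_inf q q * qpoch_inf (q * q) q) / qpoch_inf (q * q) q)%C; [field; exact Hn|].
    rewrite E; field; exact Hn. }
  rewrite <- E'; assert (E0 := omega_0_lim_eq q g Hq Hg).
  transitivity (omega q g 0 * qpoch_inf (g ^ 2) q * qpoch_inf q q)%C; [ring|].
  rewrite <- E0; ring.
Qed.

(** * The mixed integrals *)

Lemma continuous_rp_cos (b q x : R) (n : nat) : continuous (fun y => rp b q (cos y) n) x.
Proof.
  assert (Hcos : continuous cos x).
  { apply continuous_ext with (fun y => cos (1 * y)); [intros; rewrite Rmult_1_l; reflexivity|].
    apply continuous_cos_mult. }
  assert (H : continuous (fun y => rp b q (cos y) n) x /\ continuous (fun y => rp b q (cos y) (S n)) x); [|apply H].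
  induction n as [|n [IH1 IH2]].
  - split; [apply continuous_const|].
    apply continuous_ext with (fun y => cos y * (2 * (1 - b) / (1 - q))).
    + intros y; unfold rp; simpl; unfold Rdiv; as_R; ring.
    + apply continuous_Rmult; [exact Hcos | apply continuous_const].
  - split; [exact IH2|].
    apply continuous_ext with (fun y => (cos y * (2 * (1 - b * q ^ S n)) * rp b q (cos y) (S n)
      + - (1 - b ^ 2 * q ^ n) * rp b q (cos y) n) * / (1 - q ^ S (S n))).
    + intros y; rewrite <- (rp_pair_snd b q (cos y) (S n)), <- (rp_pair_snd b q (cos y) n).
      cbn [rp_pair]; unfold rp; destruct (rp_pair b q (cos y) n) as [u v]; cbn [fst snd].
      unfold Rdiv; as_R; ring.
    + apply continuous_Rmult; [|apply continuous_const].
      apply continuous_Rplus; apply continuous_Rmult; try assumption; [|apply continuous_const].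
      apply continuous_Rmult; [exact Hcos | apply continuous_const].
Qed.

Lemma rp_q_diff (q theta : R) (m : nat) : Rabs q < 1 ->
  rp q q (cos theta) (S m) = 2 * cos (INR (S m) * theta)
    + match m with O => 0 | S p => rp q q (cos theta) p end.
Proof.
  intros Hq; set (x := cos theta).
  assert (H1 : rp q q x 1 = 2 * x).
  { assert (H := one_minus_pow_pos q 0 Hq); unfold rp; simpl in *; field; lra. }
  assert (H2 : forall n, rp q q x (S (S n)) = 2 * x * rp q q x (S n) - rp q q x n).
  { intros n; assert (H := rp_rec q q x (S n) Hq); unfold lowered in H.
    assert (Hn := one_minus_pow_pos q (S n) Hq).
    apply Rmult_eq_reg_l with (1 - q ^ S (S n)); [|lra].
    replace (1 - q ^ S (S n)) with (1 - q * q ^ S n) in * by reflexivity.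
    replace (q ^ 2 * q ^ n) with (q * q ^ S n) in H by (cbn [pow]; ring).
    replace (1 - q ^ S (S n)) with (1 - q * q ^ S n) in H by reflexivity; lra. }
  assert (Hc : forall n, cos (INR (S (S n)) * theta) = 2 * x * cos (INR (S n) * theta) - cos (INR n * theta)).
  { intros n; rewrite !S_INR; replace ((INR n + 1 + 1) * theta) with ((INR n + 1) * theta + theta) by ring.
    replace (INR n * theta) with ((INR n + 1) * theta - theta) by ring.
    rewrite cos_plus, cos_minus; unfold x; ring. }
  assert (H0 : rp q q x 0 = 1) by reflexivity.
  assert (H : forall n, rp q q x (S n) = 2 * cos (INR (S n) * theta) + match n with O => 0 | S p => rp q q x p end
    /\ rp q q x (S (S n)) = 2 * cos (INR (S (S n)) * theta) + rp q q x n); [|apply H].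
  clear m; intros n; induction n as [|n [IH1 IH2]].
  - rewrite Hc, H2, H1, H0; simpl INR; rewrite Rmult_1_l, Rmult_0_l, cos_0; fold x; split; ring.
  - split; [exact IH2|].
    rewrite H2, IH2, (Hc (S n)); destruct n as [|n]; [rewrite H0, H1 in *; lra|].
    assert (E := H2 n); lra.
Qed.

Section Connection.
Context (q g : R) (Hq : 0 < Rabs q < 1) (Hg : Rabs g < 1).

Definition dint (b : R) (m n : nat) : R :=
  RInt (fun x => rp b q (cos x) m * (rp g q (cos x) n * wt q g x)) 0 PI.

Let cont (b : R) (m n : nat) (x : R) :
  continuous (fun x => rp b q (cos x) m * (rp g q (cos x) n * wt q g x)) x.
Proof.
  apply continuous_Rmult; [|apply continuous_Rmult]; try apply continuous_rp_cos.
  apply continuous_wt; assumption.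
Qed.

Let lower_l (b : R) (m n : nat) : RInt (fun x => lowered b q (rp b q (cos x)) m * (rp g q (cos x) n * wt q g x)) 0 PI
  = lowered b q (fun i => dint b i n) m.
Proof.
  destruct m as [|m]; unfold lowered.
  - rewrite (RInt_ext _ (fun _ => 0)) by (intros; as_R; ring).
    rewrite RInt_const; change scal with Rmult; apply Rmult_0_r.
  - unfold dint; rewrite <- RInt_Rscal by (intros; apply cont).
    apply RInt_ext; intros; as_R; ring.
Qed.

Let cont_lowered (b : R) (m n : nat) (x : R) :
  continuous (fun x => lowered b q (rp b q (cos x)) m * (rp g q (cos x) n * wt q g x)) x.
Proof.
  destruct m as [|m]; unfold lowered.
  - apply continuous_ext with (fun _ => 0); [intros; as_R; ring | apply continuous_const].
  - apply continuous_ext with (fun x => (1 - b ^ 2 * q ^ m) * (rp b q (cos x) m * (rp g q (cos x) n * wt q g x)));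
      [intros; as_R; ring|].
    apply continuous_Rmult; [apply continuous_const | apply cont].
Qed.

Let half_rec (b : R) (m n : nat) :
  (1 - q ^ S m) * dint b (S m) n + lowered b q (fun i => dint b i n) m
  = RInt (fun x => (1 - b * q ^ m) * (2 * cos x * (rp b q (cos x) m * (rp g q (cos x) n * wt q g x)))) 0 PI.
Proof.
  rewrite <- lower_l; unfold dint; rewrite <- RInt_Rscal, <- RInt_Rplus.
  - apply RInt_ext; intros x _; as_R.
    transitivity (((1 - q ^ S m) * rp b q (cos x) (S m) + lowered b q (rp b q (cos x)) m) * (rp g q (cos x) n * wt q g x)); [ring|].
    rewrite rp_rec by apply Hq; ring.
  - intros; apply continuous_Rmult; [apply continuous_const | apply cont].
  - intros; apply cont_lowered.
  - intros; apply cont.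
Qed.

Let cont2 (b : R) (m n : nat) (x : R) :
  continuous (fun x => 2 * cos x * (rp b q (cos x) m * (rp g q (cos x) n * wt q g x))) x.
Proof.
  apply continuous_Rmult; [|apply cont].
  apply continuous_Rmult; [apply continuous_const|].
  apply continuous_ext with (fun y => cos (1 * y)); [intros; rewrite Rmult_1_l; reflexivity|].
  apply continuous_cos_mult.
Qed.

Let dint_lower_r (b : R) (m n : nat) :
  RInt (fun x => rp b q (cos x) m * (lowered g q (rp g q (cos x)) n * wt q g x)) 0 PI
  = lowered g q (fun j => dint b m j) n.
Proof.
  destruct n as [|n]; unfold lowered.
  - rewrite (RInt_ext _ (fun _ => 0)) by (intros; as_R; ring).
    rewrite RInt_const; change scal with Rmult; apply Rmult_0_r.
  - unfold dint; rewrite <- RInt_Rscal by (intros; apply cont).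
    apply RInt_ext; intros; as_R; ring.
Qed.

Let half_rec_r (b : R) (m n : nat) :
  (1 - q ^ S n) * dint b m (S n) + lowered g q (fun j => dint b m j) n
  = RInt (fun x => (1 - g * q ^ n) * (2 * cos x * (rp b q (cos x) m * (rp g q (cos x) n * wt q g x)))) 0 PI.
Proof.
  rewrite <- dint_lower_r; unfold dint; rewrite <- RInt_Rscal, <- RInt_Rplus.
  - apply RInt_ext; intros x _; as_R.
    transitivity (((1 - q ^ S n) * rp g q (cos x) (S n) + lowered g q (rp g q (cos x)) n) * (rp b q (cos x) m * wt q g x)); [ring|].
    rewrite rp_rec by apply Hq; ring.
  - intros; apply continuous_Rmult; [apply continuous_const | apply cont].
  - intros; destruct n as [|n]; unfold lowered.
    + apply continuous_ext with (fun _ => 0); [intros; as_R; ring | apply continuous_const].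
    + apply continuous_ext with (fun x => (1 - g ^ 2 * q ^ n) * (rp b q (cos x) m * (rp g q (cos x) n * wt q g x)));
        [intros; as_R; ring|].
      apply continuous_Rmult; [apply continuous_const | apply cont].
  - intros; apply cont.
Qed.

Lemma dint_connection_rec (b : R) : connection_rec q b g (dint b).
Proof.
  intros m n; rewrite half_rec, half_rec_r, !RInt_Rscal by (intros; apply cont2); ring.
Qed.

Let h := PI * omega q g 0.

Let conn_q_step (p : nat) :
  conn q q g h 0 (S p) = 2 * (PI * omega q g (S p)) + conn q q g h 0 p.
Proof.
  assert (Hgq : Rabs (g * q) < 1) by (apply Rabs_lt_1_mult; [exact Hg | apply Hq]).
  assert (H1 := rpoch_neq_0 (g * q) q (S p) (proj2 Hq) Hgq).
  assert (H2 := rpoch_neq_0 (g * q) q p (proj2 Hq) Hgq).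
  assert (H3 := one_minus_pow_pos q p (proj2 Hq)).
  assert (H4 := one_minus_pos (g * q) q p (proj2 Hq) Hgq).
  assert (E := omega_closed q g Hq Hg (S p)).
  assert (Eb := qb_base q g p (proj2 Hq)).
  assert (Eq : 2 * (PI * omega q g (S p))
    = h * (1 + q ^ S p) * (qb q g 1 (S p) * (1 - q ^ S p)) * rpoch q q p / rpoch (g * q) q (S p)).
  { apply Rmult_eq_reg_r with (rpoch (g * q) q (S p)); [|exact H1].
    transitivity (PI * (omega q g (S p) * rpoch (g * q) q (S p) * 2)); [ring|].
    rewrite E; unfold h; cbn [rpoch] in H1 |- *; cbn [pow]; field; split; [lra | exact H2]. }
  rewrite Eq, Eb; unfold conn; cbn [Nat.add rpoch qb]; cbn [pow] in *.
  field; repeat split; lra.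
Qed.

Let dint_q_0 (m : nat) : dint q m 0 = dform q q g h m 0.
Proof.
  assert (Hstep : forall m, dint q (S m) 0 = 2 * wcos q g (S m) + match m with O => 0 | S p => dint q p 0 end).
  { intros j; unfold wcos; rewrite <- RInt_Rscal.
    - unfold dint at 1; destruct j as [|j].
      + rewrite Rplus_0_r; apply RInt_ext; intros x _; as_R.
        rewrite rp_q_diff by apply Hq; unfold rp; cbn [rp_pair fst]; ring.
      + unfold dint; rewrite <- RInt_Rplus.
        * apply RInt_ext; intros x _; as_R; rewrite rp_q_diff by apply Hq.
          unfold rp at 2 4; cbn [rp_pair fst]; ring.
        * intros; apply continuous_Rmult; [apply continuous_const|].
          apply continuous_Rmult; [apply continuous_cos_mult | apply continuous_wt; assumption].
        * intros; apply cont.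
    - intros; apply continuous_Rmult; [apply continuous_cos_mult | apply continuous_wt; assumption]. }
  assert (Heven : forall p, dint q (2 * p) 0 = conn q q g h 0 p).
  { intros p; induction p as [|p IH].
    - transitivity (wcos q g (2 * 0)); [|rewrite wcos_even by assumption; unfold conn, h; simpl; field].
      apply RInt_ext; intros x _; as_R; simpl; unfold rp; simpl; rewrite Rmult_0_l, cos_0; ring.
    - replace (2 * S p)%nat with (S (S (2 * p))) by lia.
      rewrite Hstep, IH, conn_q_step, <- wcos_even by assumption.
      replace (2 * S p)%nat with (S (S (2 * p))) by lia; reflexivity. }
  assert (Hodd : forall p, dint q (2 * p + 1) 0 = 0).
  { intros p; induction p as [|p IH].
    - simpl Nat.add; rewrite Hstep; assert (H := wcos_odd q g Hq Hg 0); simpl in H; rewrite H; ring.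
    - replace (2 * S p + 1)%nat with (S (S (2 * p + 1))) by lia.
      rewrite Hstep, IH; assert (H := wcos_odd q g Hq Hg (S p)).
      replace (2 * S p + 1)%nat with (S (S (2 * p + 1))) in H by lia; rewrite H; ring. }
  destruct (Nat.Even_or_Odd m) as [[p ->]|[p ->]].
  - rewrite Heven; symmetry; apply dform_eq; lia.
  - rewrite Hodd; symmetry; apply dform_0; lia.
Qed.

(* The case [b = q] (Chebyshev polynomials of the second kind) is known for all [m] at [n = 0] from
   the Fourier coefficients of the weight; the recurrence propagates it to all [n], in particular to
   [m = 0], where the integral no longer depends on [b]. *)
Lemma dint_dform (b : R) (m n : nat) : Rabs b < 1 -> dint b m n = dform q b g h m n.
Proof.
  intros Hb; revert m n; apply (connection_rec_unique_l q b g (proj2 Hq) Hg).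
  - apply dint_connection_rec.
  - intros i j; apply dform_rec; [apply Hq | exact Hg].
  - intros n.
    transitivity (dint q 0 n); [reflexivity|].
    rewrite (connection_rec_unique_r q q g (dint q) (dform q q g h) (proj2 Hq) (proj2 Hq)).
    + destruct n as [|n]; [|rewrite !dform_0 by lia; reflexivity].
      rewrite !(dform_eq _ _ _ _ 0 0 0) by lia; reflexivity.
    + apply dint_connection_rec.
    + intros i j; apply dform_rec; [apply Hq | exact Hg].
    + exact dint_q_0.
Qed.

Lemma wt_bound : exists K, 0 <= K /\ forall x, Rabs (wt q g x) <= K.
Proof.
  assert (H : forall f : nat -> R -> R, (forall k x, Rabs (f k x) <= 1) ->
    exists K, forall x, Rabs (Series (fun k => qb q g 1 k * f k x)) <= K).
  { intros f Hf; destruct (trig_series_bound q g Hq Hg f Hf) as [M [HM H]].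
    exists (Series M); intros x; eapply Rle_trans; [apply Series_Rabs|].
    - apply (ex_series_le (K := R_AbsRing) (V := R_CompleteNormedModule)) with M; [|exact HM].
      intros k; change (norm ?y) with (Rabs y); rewrite Rabs_Rabsolu; apply H.
    - apply Series_le; [|exact HM]; intros k; split; [apply Rabs_pos | apply H]. }
  destruct (H (fun k x => cos (INR (2 * k) * x))) as [K1 H1]; [intros; apply Rabs_cos|].
  destruct (H (fun k x => sin (INR (2 * k) * x))) as [K2 H2]; [intros; apply Rabs_sin|].
  exists (K1 * K1 + K2 * K2); split; [nra|].
  intros x; unfold wt; eapply Rle_trans; [apply Rabs_triang|].
  specialize (H1 x); specialize (H2 x); fold (wre q g x) in H1; fold (wim q g x) in H2.
  rewrite <- !RPow_abs; assert (P1 := Rabs_pos (wre q g x)); assert (P2 := Rabs_pos (wim q g x)); nra.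
Qed.

Lemma rogers_weight_wt (theta : R) : 0 <= theta <= PI ->
  rogers_weight (cos theta) g q = wt q g theta.
Proof.
  intros Ht; unfold rogers_weight; rewrite acos_cos by exact Ht.
  set (z := expi (2 * theta)).
  destruct (qb_lt_1_bound q g Hq Hg) as [M [r [HM [Hr H]]]].
  assert (E := qbinomial q (proj2 Hq) g 1 (fun k => M * r ^ k) z
    (ex_series_scal_geom M r ltac:(rewrite Rabs_pos_eq; lra)) H ltac:(unfold z; rewrite Cmod_expi; lra)).
  assert (Hn : qpoch_inf (g * z) q <> RtoC 0).
  { apply qpoch_inf_neq_0; [apply Hq|]; unfold z; rewrite Cmod_mult, Cmod_expi, Cmod_R, Rmult_1_r; exact Hg. }
  rewrite Cmult_1_l in E; rewrite <- E.
  replace (cps _ z * qpoch_inf (g * z) q / qpoch_inf (g * z) q)%C with (cps (fun k => RtoC (qb q g 1 k)) z)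
    by (field; exact Hn).
  assert (Hk : forall k, (RtoC (qb q g 1 k) * z ^ k)%C
    = (qb q g 1 k * cos (INR (2 * k) * theta), qb q g 1 k * sin (INR (2 * k) * theta))).
  { intros k; unfold z; rewrite expi_pow, mult_INR; unfold expi, RtoC, Cmult; simpl.
    replace (INR k * (2 * theta)) with ((1 + 1) * INR k * theta) by ring; f_equal; ring. }
  assert (Ec : cps (fun k => RtoC (qb q g 1 k)) z = (wre q g theta, wim q g theta)).
  { unfold cps, wre, wim; f_equal; apply Series_ext; intros k; rewrite Hk; reflexivity. }
  rewrite Ec; unfold Cmod, wt; simpl fst; simpl snd.
  replace (sqrt _ ^ 2) with (sqrt (wre q g theta ^ 2 + wim q g theta ^ 2) * sqrt (wre q g theta ^ 2 + wim q g theta ^ 2)) by ring.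
  apply sqrt_sqrt; nra.
Qed.

End Connection.

(** * The integral of the generating function *)

Lemma is_derive_acos (x : R) : -1 < x < 1 -> is_derive acos x (- / sqrt (1 - x ^ 2)).
Proof.
  intros Hx; apply is_derive_Reals, (derive_pt_eq_1 _ _ _ (derivable_pt_acos x Hx)).
  rewrite derive_pt_acos; unfold Rsqr, Rdiv; replace (x ^ 2) with (x * x) by ring; ring.
Qed.

Lemma acos_at_left_1 : filterlim acos (at_left 1) (locally 0).
Proof.
  apply filterlim_locally; intros eps.
  set (e := Rmin eps PI).
  assert (He : 0 < e) by (apply Rmin_glb_lt; [apply cond_pos | apply PI_RGT_0]).
  assert (HePI : e <= PI) by apply Rmin_r.
  assert (Hc : cos e < 1) by (rewrite <- cos_0; apply cos_decreasing_1; lra).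
  exists (mkposreal (1 - cos e) ltac:(lra)); intros y Hy Hy1.
  assert (Hy' : Rabs (y - 1) < 1 - cos e) by exact Hy.
  apply Rabs_def2 in Hy'.
  change (Rabs (acos y - 0) < eps).
  assert (Hb := acos_bound y).
  rewrite Rminus_0_r, Rabs_pos_eq by apply Hb.
  apply Rlt_le_trans with e; [|apply Rmin_l].
  apply Rnot_le_lt; intros Hle.
  assert (H := cos_decr_1 e (acos y) ltac:(lra) HePI (proj1 Hb) (proj2 Hb) Hle).
  assert (Hm := COS_bound e).
  rewrite cos_acos in H by lra; lra.
Qed.

Lemma acos_at_right_m1 : filterlim acos (at_right (-1)) (locally PI).
Proof.
  apply filterlim_locally; intros eps.
  set (e := PI - Rmin eps PI).
  assert (H0 : 0 < Rmin eps PI) by (apply Rmin_glb_lt; [apply cond_pos | apply PI_RGT_0]).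
  assert (HePI : Rmin eps PI <= PI) by apply Rmin_r.
  assert (Hc : -1 < cos e) by (rewrite <- cos_PI; apply cos_decreasing_1; unfold e; lra).
  exists (mkposreal (cos e + 1) ltac:(lra)); intros y Hy Hy1.
  assert (Hy' : Rabs (y - -1) < cos e + 1) by exact Hy.
  apply Rabs_def2 in Hy'.
  change (Rabs (acos y - PI) < eps).
  assert (Hb := acos_bound y).
  rewrite Rabs_left1 by lra.
  apply Rlt_le_trans with (Rmin eps PI); [|apply Rmin_l].
  apply Rnot_le_lt; intros Hle.
  assert (H := cos_decr_1 (acos y) e (proj1 Hb) (proj2 Hb) ltac:(unfold e; lra) ltac:(unfold e; lra) ltac:(unfold e; lra)).
  assert (Hm := COS_bound e).
  rewrite cos_acos in H by lra; lra.
Qed.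

Lemma opp_scal_opp {V : ModuleSpace R_Ring} (c : R) (v : V) : opp (scal (- c) v) = scal c v.
Proof.
  rewrite <- (scal_opp_l (- c) v); f_equal; apply Ropp_involutive.
Qed.

Lemma opp_plus_cancel {G : AbelianGroup} (x y : G) : opp y = plus x (opp (plus x y)).
Proof. rewrite opp_plus, plus_assoc, plus_opp_r, plus_zero_l; reflexivity. Qed.

Lemma is_RInt_gen_acos {V : CompleteNormedModule R_AbsRing} (f : R -> V) :
  (forall x, continuous f x) ->
  is_RInt_gen (fun x => scal (/ sqrt (1 - x ^ 2)) (f (acos x))) (at_right (-1)) (at_left 1) (RInt f 0 PI).
Proof.
  intros Hf.
  assert (Hex : forall a b, ex_RInt f a b) by (intros; apply ex_RInt_continuous; auto).
  set (F := fun u => RInt f 0 u).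
  assert (HF : forall u, continuous F u).
  { intros u; apply (continuous_RInt_1 f 0 u F), filter_forall; intros z; apply (RInt_correct f), Hex. }
  apply filterlimi_lim_ext_loc with (fun ab => plus (F (acos (fst ab))) (opp (F (acos (snd ab))))).
  - apply Filter_prod with (fun x => -1 < x < 1) (fun x => -1 < x < 1).
    + exists (mkposreal 2 ltac:(lra)); intros y Hy Hy1.
      assert (Hy' : Rabs (y - -1) < 2) by exact Hy; apply Rabs_def2 in Hy'; lra.
    + exists (mkposreal 2 ltac:(lra)); intros y Hy Hy1.
      assert (Hy' : Rabs (y - 1) < 2) by exact Hy; apply Rabs_def2 in Hy'; lra.
    + intros a b Ha Hb; cbn [fst snd].
      assert (Hin : forall x, Rmin a b <= x <= Rmax a b -> -1 < x < 1).
      { intros x [H1 H2]; split.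
        - apply Rlt_le_trans with (2 := H1); apply Rmin_glb_lt; lra.
        - apply Rle_lt_trans with (1 := H2); apply Rmax_lub_lt; lra. }
      assert (Hc := is_RInt_comp f acos (fun x => - / sqrt (1 - x ^ 2)) a b (fun x _ => Hf (acos x))).
      apply is_RInt_opp in Hc.
      * evar_last.
        -- apply is_RInt_ext with (2 := Hc); intros x _.
           exact (opp_scal_opp (V := CompleteNormedModule.ModuleSpace R_AbsRing V) _ _).
        -- unfold F; rewrite <- (RInt_Chasles f 0 (acos a) (acos b)) by apply Hex.
           exact (opp_plus_cancel (G := CompleteNormedModule.AbelianGroup R_AbsRing V) _ _).
      * intros x Hx; specialize (Hin x Hx).
        split; [apply is_derive_acos, Hin|].
        apply (ex_derive_continuous (K := R_AbsRing) (V := R_NormedModule)).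
        assert (0 < 1 - x ^ 2) by nra.
        auto_derive; repeat split; [nra|].
        apply Rgt_not_eq, sqrt_lt_R0; nra.
  - assert (E : plus (F PI) (opp (F 0)) = F PI).
    { unfold F; rewrite (RInt_point 0 f); exact (minus_zero_r (G := CompleteNormedModule.AbelianGroup R_AbsRing V) _). }
    refine (eq_ind _ (fun l => filterlim _ _ (locally l)) _ _ E).
    apply (filterlim_comp_2 (G := locally (F PI)) (H := locally (opp (F 0))) _ _ plus).
    + apply (filterlim_comp _ _ _ fst (fun x => F (acos x)) _ (at_right (-1))); [apply filterlim_fst|].
      apply (filterlim_comp _ _ _ acos F _ (locally PI)); [apply acos_at_right_m1 | apply HF].
    + apply (filterlim_comp _ _ _ (fun ab => F (acos (snd ab))) opp _ (locally (F 0))); [|exact (filterlim_opp (V := CompleteNormedModule.NormedModule R_AbsRing V) (F 0))].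
      apply (filterlim_comp _ _ _ snd (fun x => F (acos x)) _ (at_left 1)); [apply filterlim_snd|].
      apply (filterlim_comp _ _ _ acos F _ (locally 0)); [apply acos_at_left_1 | apply HF].
    + exact (filterlim_plus (V := CompleteNormedModule.NormedModule R_AbsRing V) (F PI) (opp (F 0))).
Qed.

Lemma Re_RtoC_mult (a : R) (z : C) : Re (RtoC a * z) = a * Re z.
Proof. destruct z as [u v]; unfold Cmult, RtoC, Re; simpl; ring. Qed.

Lemma Im_RtoC_mult (a : R) (z : C) : Im (RtoC a * z) = a * Im z.
Proof. destruct z as [u v]; unfold Cmult, RtoC, Im; simpl; ring. Qed.

Section Integral.
Context (q b g : R) (t : C) (n : nat) (Hq : 0 < Rabs q < 1) (Hb : Rabs b < 1) (Hg : Rabs g < 1)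
  (Hg0 : g <> 0) (Ht : Cmod t < 1).

Let h := PI * omega q g 0.
Let F (k : nat) (theta : R) : R := rp b q (cos theta) k * (rp g q (cos theta) n * wt q g theta).

Let F_bound : exists K, 0 <= K /\ forall k theta, Rabs (F k theta) <= INR (S k) * K.
Proof.
  destruct (rp_bound q b (proj2 Hq)) as [M1 [HM1 H1]].
  destruct (rp_bound q g (proj2 Hq)) as [M2 [HM2 H2]].
  destruct (wt_bound q g Hq Hg) as [K [HK H3]].
  assert (Hn := pos_INR (S n)).
  exists (M1 * (INR (S n) * M2 * K)); split.
  - repeat apply Rmult_le_pos; lra.
  - intros k theta; unfold F; rewrite !Rabs_mult, <- Rmult_assoc.
    rewrite <- (Rmult_assoc (INR (S k))), (Rmult_assoc (Rabs (rp b q (cos theta) k))).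
    apply Rmult_le_compat; auto using Rabs_pos.
    + apply Rmult_le_pos; apply Rabs_pos.
    + apply Rmult_le_compat; auto using Rabs_pos.
Qed.

Let continuous_F (k : nat) (theta : R) : continuous (F k) theta.
Proof.
  apply continuous_Rmult; [|apply continuous_Rmult]; try apply continuous_rp_cos.
  apply continuous_wt; assumption.
Qed.

Let limit_integrand (theta : R) : C :=
  (Series (fun k => Re (t ^ k) * F k theta), Series (fun k => Im (t ^ k) * F k theta)).

Let Cmod_t_pow (k : nat) : Rabs (Re (t ^ k)) <= Cmod t ^ k /\ Rabs (Im (t ^ k)) <= Cmod t ^ k.
Proof. rewrite <- Cmod_pow; split; [apply re_le_Cmod | apply im_le_Cmod]. Qed.

Let part_bound (c : nat -> R) : (forall k, Rabs (c k) <= Cmod t ^ k) ->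
  exists B, ex_series B /\ forall k theta, Rabs (c k * F k theta) <= B k.
Proof.
  intros Hc; destruct F_bound as [K [HK H]].
  exists (fun k => INR (S k) * K * Cmod t ^ k); split.
  - apply ex_series_INR_pow; split; [apply Cmod_ge_0 | exact Ht].
  - intros k theta; rewrite Rabs_mult, Rmult_comm.
    apply Rmult_le_compat; auto using Rabs_pos.
Qed.

Let continuous_part (c : nat -> R) (theta : R) : (forall k, Rabs (c k) <= Cmod t ^ k) ->
  continuous (fun y => Series (fun k => c k * F k y)) theta.
Proof.
  intros Hc; destruct (part_bound c Hc) as [B [HB H]].
  apply continuous_Series with B; [|apply filter_forall; auto | exact HB].
  intros k; apply continuous_Rmult; [apply continuous_const | apply continuous_F].
Qed.

Let RInt_part (c : nat -> R) : (forall k, Rabs (c k) <= Cmod t ^ k) ->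
  is_series (fun k => c k * dform q b g h k n) (RInt (fun y => Series (fun k => c k * F k y)) 0 PI).
Proof.
  intros Hc; destruct (part_bound c Hc) as [B [HB H]].
  apply is_series_ext with (fun k => RInt (fun y => c k * F k y) 0 PI).
  - intros k; rewrite RInt_Rscal by apply continuous_F.
    as_R; f_equal; apply dint_dform; assumption.
  - apply is_series_RInt with B; [left; apply PI_RGT_0 | | exact H | exact HB].
    intros k x; apply continuous_Rmult; [apply continuous_const | apply continuous_F].
Qed.

Let continuous_limit_integrand (theta : R) : continuous (limit_integrand : R -> C_R_CompleteNormedModule) theta.
Proof.
  apply (continuous_comp_2 (U := R_UniformSpace) (V := R_UniformSpace) (W := R_UniformSpace) (X := C_R_CompleteNormedModule)
    (fun y => Series (fun k => Re (t ^ k) * F k y)) (fun y => Series (fun k => Im (t ^ k) * F k y)) (fun x y => (x, y))).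
  - apply continuous_part; intros; apply Cmod_t_pow.
  - apply continuous_part; intros; apply Cmod_t_pow.
  - apply continuous_ext with (fun z => z); [intros [x y]; reflexivity | apply continuous_id].
Qed.

Let Clim_RInt_limit_integrand :
  Clim (sum_n (fun k => RtoC (dform q b g h k n) * t ^ k)%C) (RInt (limit_integrand : R -> C_R_CompleteNormedModule) 0 PI).
Proof.
  replace (RInt (limit_integrand : R -> C_R_CompleteNormedModule) 0 PI)
    with ((RInt (fun y => Series (fun k => Re (t ^ k) * F k y)) 0 PI, RInt (fun y => Series (fun k => Im (t ^ k) * F k y)) 0 PI) : C).
  - apply Clim_of_parts.
    + apply is_lim_seq_ext with (sum_n (fun k => Re (t ^ k) * dform q b g h k n)).
      * intros m; rewrite Re_sum_n; apply sum_n_ext; intros k; as_R; rewrite Re_RtoC_mult; ring.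
      * apply RInt_part; intros; apply Cmod_t_pow.
    + apply is_lim_seq_ext with (sum_n (fun k => Im (t ^ k) * dform q b g h k n)).
      * intros m; rewrite Im_sum_n; apply sum_n_ext; intros k; as_R; rewrite Im_RtoC_mult; ring.
      * apply RInt_part; intros; apply Cmod_t_pow.
  - symmetry; apply (is_RInt_unique (V := C_R_CompleteNormedModule)).
    apply (is_RInt_fct_extend_pair (U := R_NormedModule) (V := R_NormedModule) limit_integrand).
    + apply (RInt_correct (V := R_CompleteNormedModule)), ex_RInt_cont.
      intros; apply continuous_part; intros; apply Cmod_t_pow.
    + apply (RInt_correct (V := R_CompleteNormedModule)), ex_RInt_cont.
      intros; apply continuous_part; intros; apply Cmod_t_pow.
Qed.

Let integrand_eq_limit (theta : R) : 0 <= theta <= PI ->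
  (qpochs_inf [t * b * expi theta; t * b * expi (- theta)] q
   / qpochs_inf [t * expi theta; t * expi (- theta)] q
   * rogers n (cos theta) g q * RtoC (rogers_weight (cos theta) g q) = limit_integrand theta)%C.
Proof.
  intros Hth.
  destruct (rp_bound q b (proj2 Hq)) as [M [HM H]].
  set (B := fun k => INR (S k) * M * Cmod t ^ k).
  assert (HB : ex_series B) by (apply ex_series_INR_pow; split; [apply Cmod_ge_0 | exact Ht]).
  assert (Hs : forall k, Cmod (RtoC (rp b q (cos theta) k) * t ^ k)%C <= B k).
  { intros k; rewrite Cmod_mult, Cmod_R, Cmod_pow; apply Rmult_le_compat_r; [apply pow_le, Cmod_ge_0 | apply H]. }
  assert (E := rogers_generating q b theta t B (proj2 Hq) HB Hs).
  rewrite rogers_rp, rogers_weight_wt; try assumption; [|apply Rabs_def2 in Hg; lra].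
  assert (Hn : forall x, qpoch_inf (t * expi x)%C q <> RtoC 0).
  { intros x; apply qpoch_inf_neq_0; [apply Hq|]; rewrite Cmod_mult, Cmod_expi, Rmult_1_r; exact Ht. }
  cbn [qpochs_inf fold_right]; rewrite !Cmult_1_r, <- E.
  set (s := fun k => RtoC (rp b q (cos theta) k)).
  transitivity (cps s t * RtoC (rp g q (cos theta) n * wt q g theta))%C.
  - rewrite RtoC_mult; field; split; apply Hn.
  - assert (H1 := Clim_mult _ _ _ _ (Clim_sum_of_bound _ B Hs HB) (Clim_const (RtoC (rp g q (cos theta) n * wt q g theta)))).
    refine (Clim_unique _ _ _ H1 _).
    apply Clim_ext with (sum_n (fun k => t ^ k * RtoC (F k theta))%C).
    + intros m; rewrite Cmult_comm, <- Csum_mult; apply Csum_ext_le; intros k _; unfold F.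
      rewrite (RtoC_mult (rp b q (cos theta) k)); ring.
    + destruct F_bound as [K [HK HF]].
      assert (HL := Clim_sum_of_bound (fun k => t ^ k * RtoC (F k theta))%C (fun k => INR (S k) * K * Cmod t ^ k)).
      replace (limit_integrand theta) with ((Series (fun k => Re (t ^ k * RtoC (F k theta))%C), Series (fun k => Im (t ^ k * RtoC (F k theta))%C)) : C).
      * apply HL; [|apply ex_series_INR_pow; split; [apply Cmod_ge_0 | exact Ht]].
        intros k; rewrite Cmod_mult, Cmod_R, Cmod_pow, Rmult_comm.
        apply Rmult_le_compat_r; [apply pow_le, Cmod_ge_0 | apply HF].
      * unfold limit_integrand; f_equal; apply Series_ext; intros k; rewrite Cmult_comm, ?Re_RtoC_mult, ?Im_RtoC_mult; ring.
Qed.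

Lemma integral_limit (l : C) :
  Clim (sum_n (fun k => RtoC (dform q b g h k n) * t ^ k)%C) l ->
  is_RInt_gen (V := C_R_NormedModule)
    (fun x : R =>
       let theta := acos x in
       (qpochs_inf [t * b * expi theta; t * b * expi (- theta)] q
       / qpochs_inf [t * expi theta; t * expi (- theta)] q
       * rogers n x g q
       * RtoC (rogers_weight x g q / sqrt (1 - x ^ 2))%R)%C)
    (at_right (-1)%R) (at_left 1%R) l.
Proof.
  intros Hl; rewrite (Clim_unique _ _ _ Hl Clim_RInt_limit_integrand).
  apply (is_RInt_gen_ext (V := C_R_NormedModule) (fun x => scal (/ sqrt (1 - x ^ 2)) (limit_integrand (acos x)))).
  - apply Filter_prod with (fun x => -1 < x < 1) (fun x => -1 < x < 1).
    + exists (mkposreal 2 ltac:(lra)); intros y Hy Hy1.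
      assert (Hy' : Rabs (y - -1) < 2) by exact Hy; apply Rabs_def2 in Hy'; lra.
    + exists (mkposreal 2 ltac:(lra)); intros y Hy Hy1.
      assert (Hy' : Rabs (y - 1) < 2) by exact Hy; apply Rabs_def2 in Hy'; lra.
    + intros x y Hx Hy z [Hz1 Hz2]; cbn [fst snd] in Hz1, Hz2.
      assert (Hz : -1 <= z <= 1).
      { split; [apply Rlt_le, Rlt_trans with (2 := Hz1); apply Rmin_glb_lt; lra|].
        apply Rlt_le, (Rlt_trans _ _ _ Hz2), Rmax_lub_lt; lra. }
      rewrite <- integrand_eq_limit by apply acos_bound.
      rewrite cos_acos by exact Hz; cbv zeta; unfold Rdiv; rewrite RtoC_mult.
      set (A := (_ * rogers n z g q)%C).
      set (w := rogers_weight z g q); set (s := / sqrt (1 - z ^ 2)).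
      rewrite Cmult_assoc; destruct (A * RtoC w)%C as [u v].
      change ((s * u, s * v) = ((u, v) * RtoC s)%C); unfold Cmult, RtoC; simpl; f_equal; ring.
  - exact (is_RInt_gen_acos (V := C_R_CompleteNormedModule) limit_integrand continuous_limit_integrand).
Qed.

Let conn_ratio (j : nat) : C :=
  (qpoch (b * q ^ n) q j / qpoch (g * q ^ (n + 1)) q j * RtoC (qb q g b j))%C.

Let prefactor : R := h * (rpoch (g ^ 2) q n / rpoch q q n) * (rpoch b q n / rpoch (g * q) q n).

Let Rabs_gq : Rabs (g * q) < 1.
Proof. apply Rabs_lt_1_mult; [exact Hg | apply Hq]. Qed.

Let Cmod_gqn : Cmod (g * q ^ (n + 1))%C < 1.
Proof.
  rewrite Cpow_add_r, Cpow_1_r, <- RtoC_pow, <- !RtoC_mult, Cmod_R.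
  replace (g * (q ^ n * q)) with (q ^ n * (g * q)) by ring.
  apply Rle_lt_trans with (2 := Rabs_gq), Rabs_pow_scale, Hq.
Qed.

Let conn_eq (j : nat) : RtoC (conn q b g h n j) = (RtoC prefactor * conn_ratio j)%C.
Proof.
  unfold conn, prefactor, conn_ratio.
  assert (H1 := rpoch_neq_0 (g * q) q n (proj2 Hq) Rabs_gq).
  assert (H2 := rpoch_neq_0 (g * q) q (n + j) (proj2 Hq) Rabs_gq).
  assert (H3 := qpoch_neq_0 q (proj2 Hq) _ j Cmod_gqn).
  assert (H1' : RtoC (rpoch (g * q) q n) <> RtoC 0) by (intros E; apply RtoC_inj in E; auto).
  rewrite !RtoC_mult, (RtoC_div (rpoch b q (n + j))), (RtoC_div (rpoch b q n)) by assumption.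
  rewrite <- (qpoch_RtoC q b (n + j)), <- (qpoch_RtoC q (g * q) (n + j)), !qpoch_split.
  rewrite (qpoch_RtoC q b n), (qpoch_RtoC q (g * q) n), (RtoC_mult g q).
  replace (g * q * q ^ n)%C with (g * q ^ (n + 1))%C by (rewrite Cpow_add_r, Cpow_1_r; ring).
  field; auto.
Qed.

Let omega_0_neq_0 : omega q g 0 <> 0.
Proof.
  intros E; assert (H := omega_0_closed q g Hq Hg); rewrite E, Cmult_0_l in H.
  symmetry in H; revert H; apply Cmult_neq_0; [intros E2; apply RtoC_inj in E2; lra|].
  apply Cmult_neq_0; (apply qpoch_inf_neq_0; [apply Hq|]).
  - rewrite Cmod_R; exact Hg.
  - rewrite <- RtoC_mult, Cmod_R; exact Rabs_gq.
Qed.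

Let prefactor_neq_0 : prefactor <> 0.
Proof.
  assert (Hg2 : Rabs (g ^ 2) < 1) by (replace (g ^ 2) with (g * g) by ring; apply Rabs_lt_1_mult; exact Hg).
  assert (H := fun a => rpoch_neq_0 a q n (proj2 Hq)).
  unfold prefactor, h, Rdiv.
  apply Rmult_integral_contrapositive_currified; [apply Rmult_integral_contrapositive_currified|].
  - apply Rmult_integral_contrapositive_currified; [apply PI_neq0 | exact omega_0_neq_0].
  - apply Rmult_integral_contrapositive_currified; [|apply Rinv_neq_0_compat]; apply H; [exact Hg2 | apply Hq].
  - apply Rmult_integral_contrapositive_currified; [|apply Rinv_neq_0_compat]; apply H; [exact Hb | exact Rabs_gq].
Qed.

Let conn_ratio_bound : exists K, forall j, Cmod (conn_ratio j * (t ^ 2) ^ j)%C <= INR (S j) * K * (Cmod t * Cmod t) ^ j.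
Proof.
  destruct F_bound as [K [HK HF]].
  assert (Hpre : 0 < Rabs prefactor) by apply Rabs_pos_lt, prefactor_neq_0.
  exists (PI * (2 * INR (S n) * K) / Rabs prefactor); intros j.
  rewrite Cmod_mult, !Cmod_pow; replace (Cmod t ^ 2) with (Cmod t * Cmod t) by ring.
  apply Rmult_le_compat_r; [apply pow_le, Rmult_le_pos; apply Cmod_ge_0|].
  apply Rmult_le_reg_l with (1 := Hpre).
  replace (Rabs prefactor * (INR (S j) * (PI * (2 * INR (S n) * K) / Rabs prefactor)))
    with ((PI - 0) * (2 * INR (S n) * INR (S j) * K)) by (field; lra).
  rewrite <- Cmod_R, <- Cmod_mult, <- conn_eq, Cmod_R, <- dform_conn.
  rewrite <- (dint_dform q g Hq Hg b _ _ Hb).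
  apply abs_RInt_le_const; [left; apply PI_RGT_0 | apply ex_RInt_cont, continuous_F |].
  intros x _; eapply Rle_trans; [apply HF|]; apply Rmult_le_compat_r; [exact HK|].
  replace 2 with (INR 2) by reflexivity; rewrite <- !mult_INR; apply le_INR; nia.
Qed.

Lemma series_limit : exists l, Clim (sum_n (fun j => conn_ratio j * (t ^ 2) ^ j)%C) l /\
  Clim (sum_n (fun k => RtoC (dform q b g h k n) * t ^ k)%C) (RtoC prefactor * l * t ^ n)%C.
Proof.
  destruct conn_ratio_bound as [K HK].
  assert (Ht2 : 0 <= Cmod t * Cmod t < 1) by (assert (H := Cmod_ge_0 t); nra).
  assert (Hl := Clim_sum_of_bound _ _ HK (ex_series_INR_pow K _ Ht2)).
  eexists; split; [exact Hl|].
  set (l := (_, _)) in Hl; fold l.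
  replace (RtoC prefactor * l * t ^ n)%C with (RInt (limit_integrand : R -> C_R_CompleteNormedModule) 0 PI : C);
    [exact Clim_RInt_limit_integrand|].
  apply Clim_unique with (fun m => RtoC prefactor * sum_n (fun j => conn_ratio j * (t ^ 2) ^ j)%C m * t ^ n)%C.
  - assert (H := Clim_subseq _ _ (fun m => n + 2 * m)%nat ltac:(intros; cbv beta; lia) Clim_RInt_limit_integrand).
    eapply Clim_ext; [|exact H]; clear H; intros m; cbv beta.
    assert (Hz : forall k, (forall i, k <> n + 2 * i)%nat -> (RtoC (dform q b g h k n) * t ^ k = 0)%C).
    { intros k Hk; rewrite dform_0 by exact Hk; ring. }
    assert (Hj : forall j, (RtoC (dform q b g h (n + 2 * j) n) * t ^ (n + 2 * j)
      = RtoC prefactor * (conn_ratio j * (t ^ 2) ^ j) * t ^ n)%C).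
    { intros j; rewrite dform_conn, conn_eq, Cpow_add_r, Cpow_mult_r; ring. }
    induction m as [|m IH].
    + rewrite Csum_0, Nat.mul_0_r, Nat.add_0_r.
      assert (E := Hj 0%nat); rewrite Nat.mul_0_r, Nat.add_0_r in E; rewrite <- E.
      assert (Hlt : forall i, (i < n)%nat -> sum_n (fun k => RtoC (dform q b g h k n) * t ^ k)%C i = RtoC 0).
      { intros i; induction i as [|i IHi]; intros Hi.
        - rewrite Csum_0; apply Hz; lia.
        - rewrite Csum_S, IHi, Hz by lia; as_C; ring. }
      destruct n as [|n']; [apply Csum_0|].
      rewrite Csum_S, Hlt by lia; as_C; ring.
    + replace (n + 2 * S m)%nat with (S (S (n + 2 * m))) by lia.
      rewrite !Csum_S, IH, (Hz (S (n + 2 * m))) by lia.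
      replace (S (S (n + 2 * m))) with (n + 2 * S m)%nat by lia.
      rewrite Hj; as_C; ring.
  - apply Clim_mult; [apply Clim_mult|]; auto using Clim_const.
Qed.

Let qpoch_div_qb (j : nat) : (qpoch (b * / g) q j / qpoch q q j * g ^ j = RtoC (qb q g b j))%C.
Proof.
  assert (Hgc : RtoC g <> RtoC 0) by (intros E; apply RtoC_inj in E; auto).
  induction j as [|j IH]; [cbn [qpoch qb Cpow]; field; apply C1_nz|].
  assert (H1 := qpoch_neq_0 q (proj2 Hq) q j); rewrite Cmod_R in H1.
  assert (H2 := qpoch_neq_0 q (proj2 Hq) q (S j)); rewrite Cmod_R in H2; cbn [qpoch] in H2.
  assert (H3 := one_minus_pow_pos q j (proj2 Hq)).
  assert (H4 : (1 - q * q ^ j)%C <> RtoC 0).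
  { rewrite <- Cpow_S, <- RtoC_pow, <- RtoC_minus; intros E; apply RtoC_inj in E; lra. }
  cbn [qpoch qb]; rewrite RtoC_div by lra; rewrite RtoC_mult, <- IH, !RtoC_minus, RtoC_mult, !RtoC_pow, !Cpow_S.
  field; repeat split; auto; apply H1; apply Hq.
Qed.

Lemma bhs_conn_ratio (l : C) : Clim (sum_n (fun j => conn_ratio j * (t ^ 2) ^ j)%C) l ->
  bhs [(b * / g)%C; (b * q ^ n)%C] [(g * q ^ (n + 1))%C] q (g * t ^ 2)%C = l.
Proof.
  intros Hl; apply CLim_seq_Clim; eapply Clim_ext; [|exact Hl].
  intros m; apply Csum_ext_le; intros j _.
  unfold conn_ratio; rewrite <- qpoch_div_qb.
  unfold qpochs; cbn [fold_right length]; simpl Z.of_nat; simpl Cpowz.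
  rewrite !Cmult_1_r, Cpow_mult_l.
  assert (H1 := qpoch_neq_0 q (proj2 Hq) q j); rewrite Cmod_R in H1; specialize (H1 (proj2 Hq)).
  assert (H2 := qpoch_neq_0 q (proj2 Hq) _ j Cmod_gqn).
  field; auto.
Qed.

Lemma prefactor_eq : RtoC prefactor =
  (2 * PI * (qpochs_inf [RtoC g; g * q] q * qpochs [RtoC b; g ^ 2] q n
        / (qpochs_inf [g ^ 2; RtoC q] q * qpochs [RtoC q; q * g] q n)))%C.
Proof.
  assert (Hg2 : Rabs (g ^ 2) < 1) by (replace (g ^ 2) with (g * g) by ring; apply Rabs_lt_1_mult; exact Hg).
  assert (N1 := rpoch_neq_0 (g * q) q n (proj2 Hq) Rabs_gq).
  assert (N2 := rpoch_neq_0 q q n (proj2 Hq) (proj2 Hq)).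
  assert (N1' : RtoC (rpoch (g * q) q n) <> RtoC 0) by (intros E; apply RtoC_inj in E; auto).
  assert (N2' : RtoC (rpoch q q n) <> RtoC 0) by (intros E; apply RtoC_inj in E; auto).
  assert (N3 : qpoch_inf (g ^ 2) q <> RtoC 0).
  { apply qpoch_inf_neq_0; [apply Hq|]; rewrite <- RtoC_pow, Cmod_R; exact Hg2. }
  assert (N4 : qpoch_inf q q <> RtoC 0) by (apply qpoch_inf_neq_0; [|rewrite Cmod_R]; apply Hq).
  assert (Eo := omega_0_closed q g Hq Hg).
  assert (Eo' : RtoC (omega q g 0) = (2 * (qpoch_inf g q * qpoch_inf (g * q) q) / (qpoch_inf (g ^ 2) q * qpoch_inf q q))%C).
  { rewrite <- Eo; field; auto. }
  unfold prefactor, h, qpochs, qpochs_inf; cbn [fold_right]; rewrite !Cmult_1_r.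
  rewrite !RtoC_mult, !RtoC_div, Eo' by assumption.
  rewrite <- (RtoC_pow g 2), <- !RtoC_mult, !qpoch_RtoC, (Rmult_comm q g).
  rewrite (RtoC_mult 2 PI), RtoC_pow in *; rewrite ?RtoC_mult in *.
  field; repeat split; assumption.
Qed.

End Integral.

Open Scope C_scope.

Theorem corollary20 (n : nat) (beta gamma q : R) (t : C)
  (hbeta : (-1 < beta < 1)%R) (hbeta0 : beta <> 0%R)
  (hgamma : (-1 < gamma < 1)%R) (hgamma0 : gamma <> 0%R)
  (hq : (0 < Rabs q < 1)%R) (ht : (Cmod t < 1)%R) :
  is_RInt_gen (V := C_R_NormedModule)
    (fun x : R =>
       let theta := acos x in
       qpochs_inf [t * beta * expi theta; t * beta * expi (- theta)] q
       / qpochs_inf [t * expi theta; t * expi (- theta)] q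
       * rogers n x gamma q
       * RtoC (rogers_weight x gamma q / sqrt (1 - x ^ 2))%R)
    (at_right (-1)%R) (at_left 1%R)
    (2 * PI
     * (qpochs_inf [RtoC gamma; gamma * q] q * qpochs [RtoC beta; gamma ^ 2] q n
        / (qpochs_inf [gamma ^ 2; RtoC q] q * qpochs [RtoC q; q * gamma] q n))
     * bhs [beta * / gamma; beta * q ^ n] [gamma * q ^ (n + 1)] q (gamma * t ^ 2)
     * t ^ n).
Proof.
  assert (Hb : (Rabs beta < 1)%R) by (apply Rabs_def1; lra).
  assert (Hg : (Rabs gamma < 1)%R) by (apply Rabs_def1; lra).
  destruct (series_limit q beta gamma t n hq Hb Hg hgamma0 ht) as [l [Hl Hint]].
  rewrite (bhs_conn_ratio q beta gamma t n hq Hg hgamma0 l Hl).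
  rewrite <- (prefactor_eq q beta gamma n hq Hg).
  exact (integral_limit q beta gamma t n hq Hb Hg hgamma0 ht _ Hint).
Qed.
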